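(* Let $D\in\mathrm{Mat}_{d\times d}(\mathcal{L})$ be a non-zero matrix ($d\ge1$), and let $\lambda_d\in\mathcal{L}[t]$ be its last invariant factor. For $n\ge1$ let $s_n$ be the least non-negative integer such that all entries of $D,D^2,\dots,D^n$ have valuation $\ge -s_n$. The following are equivalent: (1) there is $n\ge1$ such that $\sigma^{s_n}D^n\in\mathrm{Mat}_{d\times d}(\mathcal{O})$ has rank $d$ modulo $\sigma^{s_n}$; (2) there is $n\ge1$ such that the block column matrix with blocks $\sigma^{s_n}D,\sigma^{s_n}D^2,\dots,\sigma^{s_n}D^n$ (stacked vertically, in $\mathrm{Mat}_{nd\times d}(\mathcal{O})$) has rank $d$ modulo $\sigma^{s_n}$; (2') there is $n\ge1$ such that the block row matrix $(\sigma^{s_n}D,\sigma^{s_n}D^2,\dots,\sigma^{s_n}D^n)\in\mathrm{Mat}_{d\times nd}(\mathcal{O})$ has rank $d$ modulo $\sigma^{s_n}$; (3) all slopes of the Newton polygon of $\lambda_d$ are positive.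
   Context: $(\mathcal{L},v)$ is a complete discretely valued skew field: a division ring with a map $v:\mathcal{L}\to\mathbb{Z}\cup\{\infty\}$ with $v(x)=\infty\iff x=0$, $v(x+y)\ge\min\{v(x),v(y)\}$, $v(xy)=v(x)+v(y)$, such that every series $\sum x_i$ with $v(x_i)\to\infty$ converges. $\mathcal{O}=\{x:v(x)\ge0\}$ is its valuation ring and $\sigma\in\mathcal{O}$ a fixed uniformizer ($v(\sigma)=1$). $\mathcal{L}[t]$ is the polynomial ring in a central indeterminate $t$. Rank modulo $\sigma^s$: any rectangular matrix $B$ over $\mathcal{O}$ can be brought by elementary row and column operations over $\mathcal{O}$ to a diagonal form whose non-zero diagonal entries are $\sigma^{\nu_1},\dots,\sigma^{\nu_n}$ with $0\le\nu_1\le\dots\le\nu_n$; $B$ has rank $r$ modulo $\sigma^s$ if $\#\{i:\nu_i<s\}=r$. Invariant factors of $D$: monic $\lambda_1,\dots,\lambda_d\in\mathcal{L}[t]$ obtained by bringing $t\mathbf{1}_d-D$ to diagonal form $\mathrm{diag}(\lambda_1,\dots,\lambda_d)$ by elementary row and column operations over $\mathcal{L}[t]$, with each $\lambda_i$ a left and right divisor of $\lambda_{i+1}$ (Newton polygons are independent of choices). Newton polygon of $f=\sum a_it^i\in\mathcal{L}[t]$: lower convex hull of the points $(i,v(a_i))$, $a_i\ne0$; slope of an edge from $(i,w_i)$ to $(j,w_j)$ is $(w_j-w_i)/(j-i)$. ''All slopes positive'' is understood to include that the constant coefficient is non-zero. *)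

(* Defs.v *)
From HB Require Import structures.
From mathcomp Require Import all_boot all_order all_algebra.
Set Implicit Arguments. Unset Strict Implicit. Unset Printing Implicit Defensive.
Import Order.TTheory GRing.Theory Num.Theory.
Local Open Scope ring_scope.

(* The valuation v : L -> Z \cup {oo} is encoded as v : L -> int that *)
(* is only meaningful on non-zero elements (v 0 = oo by convention).  *)

(* "v(x) >= k", with the convention v(0) = +oo *)
Definition vge (R : nzRingType) (v : R -> int) (x : R) (k : int) : Prop :=
  x = 0 \/ k <= v x.

Definition vconverges (R : nzRingType) (v : R -> int) (S : nat -> R) (l : R) :=
  forall N : int, exists M : nat, forall n, (M <= n)%N -> vge v (S n - l) N.

Record complete_dv_skew_field (R : unitRingType) (v : R -> int) (sigma : R)
  : Prop := {
  dv_division : forall x : R, x != 0 -> x \is a GRing.unit;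
  dv_mul : forall x y : R, x != 0 -> y != 0 -> v (x * y) = v x + v y;
  dv_add : forall x y : R, x != 0 -> y != 0 -> x + y != 0 ->
             Order.min (v x) (v y) <= v (x + y);
  dv_complete : forall u : nat -> R,
      (forall N : int, exists M : nat, forall i, (M <= i)%N -> vge v (u i) N) ->
      exists l : R, vconverges v (fun n => \sum_(i < n) u i) l;
  dv_unif_neq0 : sigma != 0;
  dv_unif : v sigma = 1
}.

Definition elemmx (R : nzRingType) (S U : R -> Prop) n (E : 'M[R]_n) : Prop :=
  (exists (i j : 'I_n) (a : R), i != j /\ S a /\ E = 1%:M + a *: delta_mx i j)
  \/ (exists i j : 'I_n, E = tperm_mx i j)
  \/ (exists (i : 'I_n) (u : R), U u /\ E = 1%:M + (u - 1) *: delta_mx i i).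

Inductive elemprod (R : nzRingType) (S U : R -> Prop) n : 'M[R]_n -> Prop :=
  | elemprod1 : elemprod S U 1%:M
  | elemprodS (E M : 'M[R]_n) :
      elemmx S U E -> elemprod S U M -> elemprod S U (E *m M).

Definition inO (R : nzRingType) (v : R -> int) (x : R) : Prop := vge v x 0.
Definition unitO (R : nzRingType) (v : R -> int) (x : R) : Prop :=
  x != 0 /\ v x = 0.

Definition mxO (R : nzRingType) (v : R -> int) m n (B : 'M[R]_(m, n)) : Prop :=
  forall i j, inO v (B i j).

(* B has rank r modulo sigma^s: B can be brought by elementary row and   *)
(* column operations over O to a (rectangular) diagonal form whose      *)
(* non-zero diagonal entries are powers sigma^nu_i, and exactly r of the *)
(* nu_i are < s  (nu_i = v(entry) since v sigma = 1).                   *)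
Definition rank_mod (R : nzRingType) (v : R -> int) (sigma : R) (s : nat)
  m n (B : 'M[R]_(m, n)) (r : nat) : Prop :=
  exists (P : 'M[R]_m) (Q : 'M[R]_n),
    elemprod (inO v) (unitO v) P /\ elemprod (inO v) (unitO v) Q /\
    let A := P *m B *m Q in
    (forall (i : 'I_m) (j : 'I_n), (i : nat) != j -> A i j = 0) /\
    (forall (i : 'I_m) (j : 'I_n), (i : nat) = j ->
        A i j = 0 \/ exists nu : nat, A i j = sigma ^+ nu) /\
    #|[set i : 'I_m | [exists j : 'I_n,
        [&& (i == j :> nat), A i j != 0 & v (A i j) < s%:Z]]]| = r.

Definition sbound (R : nzRingType) (v : R -> int) d (D : 'M[R]_d) (n s : nat)
  : Prop :=
  forall k : nat, (1 <= k <= n)%N -> forall i j, vge v ((D ^+ k) i j) (- s%:Z).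

Definition is_sn (R : nzRingType) (v : R -> int) d (D : 'M[R]_d) (n s : nat)
  : Prop :=
  sbound v D n s /\ forall s', sbound v D n s' -> (s <= s')%N.

(* Newton polygon of f = sum a_i t^i: lower convex hull of the points  *)
(* (i, v(a_i)), a_i != 0.  A pair i < j of such points spans a segment *)
(* of the lower boundary iff no point lies strictly below the line     *)
(* through them; the slopes of these segments are exactly the slopes   *)
(* of the edges of the Newton polygon.                                 *)
Definition np_slope (R : nzRingType) (v : R -> int) (f : {poly R}) (i j : nat)
  : rat := ((v f`_j - v f`_i)%:~R) / ((j - i)%N%:R).

Definition np_edge (R : nzRingType) (v : R -> int) (f : {poly R}) (i j : nat)
  : Prop :=
  (i < j)%N /\ f`_i != 0 /\ f`_j != 0 /\
  forall k : nat, f`_k != 0 ->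
    (v f`_i)%:~R + np_slope v f i j * ((k%:Z - i%:Z)%:~R) <= ((v f`_k)%:~R : rat).

Definition np_slopes_pos (R : nzRingType) (v : R -> int) (f : {poly R}) : Prop :=
  f`_0 != 0 /\ forall i j, np_edge v f i j -> 0 < np_slope v f i j.

Definition ldivp (R : nzRingType) (a b : {poly R}) : Prop := exists c, b = a * c.
Definition rdivp (R : nzRingType) (a b : {poly R}) : Prop := exists c, b = c * a.

Definition polyS (R : nzRingType) (p : {poly R}) : Prop := True.
Definition polyU (R : nzRingType) (p : {poly R}) : Prop :=
  exists c : R, c != 0 /\ p = c%:P.

Definition charmx (R : nzRingType) d (D : 'M[R]_d) : 'M[{poly R}]_d :=
  'X%:M - map_mx polyC D.

Definition invariant_factors (R : nzRingType) d (D : 'M[R]_d)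
  (lam : 'I_d -> {poly R}) : Prop :=
  (exists P Q : 'M[{poly R}]_d,
     elemprod (@polyS R) (@polyU R) P /\ elemprod (@polyS R) (@polyU R) Q /\
     P *m charmx D *m Q = \matrix_(i, j) (if i == j then lam i else 0)) /\
  (forall i, lam i \is monic) /\
  (forall i j : 'I_d, (j : nat) = i.+1 -> ldivp (lam i) (lam j) /\ rdivp (lam i) (lam j)).

(* Main.v *)
(* Elementary divisors show that (1), (2), (2') say respectively that [E D^n = 1],
   [\sum_k E_k D^k = 1], [\sum_k D^k E_k = 1] is solvable with coefficients in the
   maximal ideal.  Each relation makes [D] invertible and its inverse [N] satisfies
   a linear recurrence with small coefficients, so [N^k -> 0], which in turn gives (1).
   The slopes of [f] are all positive iff the constant coefficient is the strict
   unique minimum of the valuation on the coefficients of [f], a property inherited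
   by factors (Gauss' lemma).  If [N^k -> 0] then, in Smith coordinates, each
   invariant factor divides some [t^k g - 1] with [g] small, hence has this property.
   Conversely, if the last factor has it then so do all, and a power of the Smith form
   yields a relation [\sum_k D^k E_k = 1]. *)
Require Import Defs.
From HB Require Import structures.
From mathcomp Require Import all_boot all_order all_algebra.
From mathcomp Require Import fingroup perm zify.
From Stdlib Require Import Classical_Prop.
Import Order.TTheory GRing.Theory Num.Theory.
Local Open Scope ring_scope.
Set Implicit Arguments. Unset Strict Implicit. Unset Printing Implicit Defensive.

(** Over a skew field there is no determinant, no characteristic polynomial and no Cayley-Hamilton
    theorem, so every argument about [D] goes through diagonal forms. They are needed over three
    rings: over the valuation ring for ranks, over polynomials for invariant factors, and over the
    skew field itself to see that one-sided inverses are two-sided. One Smith theorem serves all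
    three. The maximal ideal enters because rank counts exponents strictly below [s]: inverting
    [sigma ^+ nu] with [nu <= s - 1] gives valuation at least [1 - s], and the factor [sigma ^+ s]
    raises the bound to [1], whatever [s] is. The matrices bringing [charmx D] to diagonal form are
    invertible over polynomials, but their coefficients need not be integral, so conjugating by them
    loses valuation. The loss is bounded and is outweighed by passing to high powers, in both
    directions between [D] and its invariant factors. Uniqueness of invariant factors is avoided:
    one implication constructs suitable factors, the other starts from arbitrary ones. *)

Lemma ex_least (P : nat -> Prop) :
  (exists n, P n) -> exists n, P n /\ forall k, P k -> (n <= k)%N.
Proof.
case=> n; elim/ltn_ind: n => n IHn Pn.
case: (classic (exists k, (k < n)%N /\ P k)) => [[k [lt_kn Pk]]|Hmin].
  exact: IHn lt_kn Pk.
exists n; split=> // k Pk; rewrite leqNgt; apply/negP=> lt_kn.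
by apply: Hmin; exists k.
Qed.

(** * Elementary matrices and their products *)

Section ScaledDelta.
Variable A : nzRingType.

Lemma mulmx_scale_delta m n p (M : 'M[A]_(m, n)) a i (j : 'I_p) x y :
  (M *m (a *: delta_mx i j)) x y = (M x i * a) *+ (y == j).
Proof.
rewrite mxE (bigD1 i) //= big1 ?addr0 => [|k /negPf nki].
  by rewrite !mxE eqxx /= mulr_natr mulrnAr.
by rewrite !mxE nki /= !mulr0.
Qed.

Lemma scale_delta_mulmx m n p (M : 'M[A]_(m, n)) a (i : 'I_p) j x y :
  ((a *: delta_mx i j) *m M) x y = (a * M j y) *+ (x == i).
Proof.
rewrite mxE (bigD1 j) //= big1 ?addr0 => [|k /negPf nkj].
  by rewrite !mxE eqxx andbT mulr_natr mulrnAl.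
by rewrite !mxE nkj andbF mulr0 mul0r.
Qed.

End ScaledDelta.

Section Elementary.
Variables (A : nzRingType) (S U : A -> Prop).

(** The subring is a predicate on the ambient ring, not a type: matrices over the valuation ring and
    their inverses over the skew field then live in the same matrix type. *)
Record subring_with_units : Prop := {
  sub1 : S 1;
  subB : forall a b, S a -> S b -> S (a - b);
  subM : forall a b, S a -> S b -> S (a * b);
  subU : forall u, U u -> S u /\ exists w, [/\ U w, u * w = 1 & w * u = 1]
}.

Hypothesis hS : subring_with_units.

Definition mx_in m n (M : 'M[A]_(m, n)) := forall i j, S (M i j).

Lemma sub0 : S 0. Proof. by rewrite -(subrr 1); apply: subB (sub1 hS) (sub1 hS). Qed.

Lemma subN a : S a -> S (- a).
Proof. by rewrite -sub0r; apply: subB sub0. Qed.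

Lemma subD a b : S a -> S b -> S (a + b).
Proof. by move=> Sa Sb; rewrite -(opprK b); apply/subB/subN. Qed.

Lemma sub_natmul a (b : bool) : S a -> S (a *+ b).
Proof. by case: b => //= _; exact: sub0. Qed.

Lemma mx_in_mul m n p (M : 'M_(m, n)) (M' : 'M_(n, p)) :
  mx_in M -> mx_in M' -> mx_in (M *m M').
Proof.
move=> SM SM' i j; rewrite mxE; apply: big_ind => [|a b|k _].
- exact: sub0.
- exact: subD.
- exact: subM.
Qed.

Lemma mx_in_scalar n a : S a -> mx_in (a%:M : 'M_n).
Proof. by move=> Sa i j; rewrite mxE; apply: sub_natmul. Qed.

Lemma mx_in_elem n (i j : 'I_n) a : S a -> mx_in (1%:M + a *: delta_mx i j).
Proof.
move=> Sa x y; rewrite !mxE mulr_natr; apply: subD; apply: sub_natmul => //.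
exact: sub1.
Qed.

Lemma mul_elem n (i j k l : 'I_n) (a b : A) :
  (1%:M + a *: delta_mx i j) *m (1%:M + b *: delta_mx k l) =
  1%:M + a *: delta_mx i j + b *: delta_mx k l
    + ((a * b) *+ (j == k)) *: delta_mx i l.
Proof.
rewrite mulmxDl mulmxDr !mul1mx mulmxDr !mulmx1 -!addrA; congr (_ + _).
rewrite addrCA; congr (_ + (_ + _)); apply/matrixP=> x y.
rewrite mulmx_scale_delta !mxE.
rewrite (eq_sym k).
by case: (x == i); case: (j == k); case: (y == l);
  rewrite /= ?(mulr0n, mulr1n, mulr1, mulr0, mul0r).
Qed.

Lemma elemmx_inv n (E : 'M[A]_n) : elemmx S U E ->
  mx_in E /\ exists E', [/\ mx_in E', E *m E' = 1%:M & E' *m E = 1%:M].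
Proof.
have Nsub a : S a -> S (a - 1) by move=> Sa; apply: subB => //; exact: sub1.
case=> [[i [j [a [nij [Sa ->]]]]]|[[i [j ->]]|[i [u [Uu ->]]]]].
- split; first exact: mx_in_elem.
  exists (1%:M + (- a) *: delta_mx i j); split.
  + exact/mx_in_elem/subN.
  + rewrite mul_elem (eq_sym j) (negPf nij) mulr0n scale0r addr0.
    by rewrite scaleNr addrK.
  + rewrite mul_elem (eq_sym j) (negPf nij) mulr0n scale0r addr0.
    by rewrite scaleNr addrNK.
- have Sp : mx_in (tperm_mx i j).
    by move=> x y; rewrite !mxE; apply: sub_natmul (sub1 hS).
  split=> //; exists (tperm_mx i j).
  by split=> //; rewrite /tperm_mx -perm_mxM tperm2 perm_mx1.
- have [Su [w [Uw uw wu]]] := subU hS Uu; have [Sw _] := subU hS Uw.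
  split; first exact/mx_in_elem/Nsub.
  exists (1%:M + (w - 1) *: delta_mx i i); split; first exact/mx_in_elem/Nsub.
  + rewrite mul_elem eqxx mulr1n -!addrA -!scalerDl mulrBr mulr1 mulrBl mul1r.
    by rewrite uw -(opprB w) (addrA (w - 1)) subrr add0r subrr scale0r addr0.
  + rewrite mul_elem eqxx mulr1n -!addrA -!scalerDl mulrBr mulr1 mulrBl mul1r.
    by rewrite wu -(opprB u) (addrA (u - 1)) subrr add0r subrr scale0r addr0.
Qed.

Lemma elemprod_inv n (P : 'M[A]_n) : elemprod S U P ->
  mx_in P /\ exists P', [/\ mx_in P', P *m P' = 1%:M & P' *m P = 1%:M].
Proof.
elim=> [|E M /elemmx_inv[SE [E' [SE' EE' E'E]]] _ [SM [M' [SM' MM' M'M]]]].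
  have S1 := mx_in_scalar (n := n) (sub1 hS).
  by split=> //; exists 1%:M; rewrite mulmx1.
split; first exact: mx_in_mul.
exists (M' *m E'); split; first exact: mx_in_mul.
- by rewrite mulmxA -(mulmxA E) MM' mulmx1.
- by rewrite mulmxA -(mulmxA M') E'E mulmx1.
Qed.

Lemma elemprod_mul n (P Q : 'M[A]_n) :
  elemprod S U P -> elemprod S U Q -> elemprod S U (P *m Q).
Proof.
move=> EP EQ; elim: EP => [|E M HE _ IH]; first by rewrite mul1mx.
by rewrite -mulmxA; apply: elemprodS.
Qed.

Lemma elemprod_elem n (E : 'M[A]_n) : elemmx S U E -> elemprod S U E.
Proof. by rewrite -{2}(mulmx1 E) => HE; apply: elemprodS HE (elemprod1 _ _ _). Qed.

Lemma elemprod_lift n (P : 'M[A]_n) : elemprod S U P ->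
  elemprod S U (block_mx 1%:M 0 0 P : 'M_(1 + n)).
Proof.
have lift_elem (i j : 'I_n) a :
    block_mx 1%:M 0 0 (1%:M + a *: delta_mx i j)
    = 1%:M + a *: delta_mx (rshift 1 i) (rshift 1 j) :> 'M[A]_(1 + n).
  rewrite [1%:M in RHS]scalar_mx_block.
  have -> : delta_mx (rshift 1 i) (rshift 1 j)
            = block_mx 0 0 0 (delta_mx i j) :> 'M[A]_(1 + n).
    apply/matrixP=> x y; rewrite -(splitK x) -(splitK y).
    case: (split x) => x'; case: (split y) => y' /=;
    by rewrite ?block_mxEul ?block_mxEur ?block_mxEdl ?block_mxEdr !mxE
      ?eq_lrshift ?eq_rlshift ?eq_rshift ?andbF.
  by rewrite scale_block_mx add_block_mx !scaler0 !addr0.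
elim=> [|E M HE _ IH]; first by rewrite -scalar_mx_block; exact: elemprod1.
have -> : block_mx 1%:M 0 0 (E *m M)
          = block_mx 1%:M 0 0 E *m block_mx 1%:M 0 0 M :> 'M[A]_(1 + n).
  by rewrite mulmx_block !mulmx0 !mul0mx mulmx1 !addr0 add0r.
apply: elemprodS IH; case: HE => [[i [j [a [nij [Sa ->]]]]]|[[i [j ->]]|[i [u [Uu ->]]]]].
- left; exists (rshift 1 i), (rshift 1 j), a; rewrite lift_elem.
  by rewrite (inj_eq (@rshift_inj _ _)).
- right; left; exists (rshift 1 i), (rshift 1 j).
  have rP k l x : rshift 1 (tperm k l x : 'I_n) = tperm (rshift 1 k) (rshift 1 l) (rshift 1 x).
    exact: (inj_tperm _ _ _ (@rshift_inj 1 n)).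
  apply/matrixP=> x y; rewrite -(splitK x) -(splitK y).
  case: (split x) => x'; case: (split y) => y' /=;
  rewrite ?block_mxEul ?block_mxEur ?block_mxEdl ?block_mxEdr !mxE -?rP;
  rewrite ?eq_lrshift ?eq_rlshift ?eq_rshift //; rewrite tpermD ?eq_rlshift //.
  by rewrite eq_lrshift.
- by right; right; exists (rshift 1 i), u; rewrite lift_elem.
Qed.

End Elementary.

(** * Smith normal form over a non-commutative Euclidean ring *)

Section Smith.
Variables (A : nzRingType) (S U : A -> Prop) (size_of : A -> nat) (nrm : A -> Prop).

(** Division is required on both sides, since column operations multiply on the right and row
    operations on the left. [nrm] singles out the normalised diagonal entries: powers of [sigma], or
    monic polynomials. *)
Record euclidean : Prop := {
  euclid_sub : subring_with_units S U;
  euclid_divl : forall a b, S a -> S b -> a != 0 ->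
    exists q, S q /\ (b - a * q = 0 \/ (size_of (b - a * q) < size_of a)%N);
  euclid_divr : forall a b, S a -> S b -> a != 0 ->
    exists q, S q /\ (b - q * a = 0 \/ (size_of (b - q * a) < size_of a)%N);
  euclid_nrm : forall a, S a -> a != 0 ->
    exists u, [/\ U u, nrm (a * u) & size_of (a * u) = size_of a]
}.

Hypothesis hE : euclidean.
Let hS := euclid_sub hE.

Definition equiv_mx m n (M M' : 'M[A]_(m, n)) :=
  exists P Q, [/\ elemprod S U P, elemprod S U Q & M' = P *m M *m Q].

Lemma equiv_mx_refl m n (M : 'M_(m, n)) : equiv_mx M M.
Proof.
by exists 1%:M, 1%:M; split; [exact: elemprod1 | exact: elemprod1 | rewrite mul1mx mulmx1].
Qed.

Lemma equiv_mx_trans m n (M1 M2 M3 : 'M_(m, n)) :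
  equiv_mx M1 M2 -> equiv_mx M2 M3 -> equiv_mx M1 M3.
Proof.
move=> [P [Q [EP EQ ->]]] [P' [Q' [EP' EQ' ->]]].
by exists (P' *m P), (Q *m Q'); split;
  [exact: elemprod_mul | exact: elemprod_mul | rewrite !mulmxA].
Qed.

Lemma equiv_mx_row m n (M : 'M_(m, n)) E : elemmx S U E -> equiv_mx M (E *m M).
Proof.
move=> HE; exists E, 1%:M.
by split; [exact: elemprod_elem | exact: elemprod1 | rewrite mulmx1].
Qed.

Lemma equiv_mx_col m n (M : 'M_(m, n)) E : elemmx S U E -> equiv_mx M (M *m E).
Proof.
move=> HE; exists 1%:M, E.
by split; [exact: elemprod1 | exact: elemprod_elem | rewrite mul1mx].
Qed.

Lemma equiv_mx_in m n (M M' : 'M_(m, n)) : equiv_mx M M' -> mx_in S M -> mx_in S M'.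
Proof.
move=> [P [Q [EP EQ ->]]] SM.
have [SP _] := elemprod_inv hS EP; have [SQ _] := elemprod_inv hS EQ.
by apply: (mx_in_mul hS) => //; apply: (mx_in_mul hS).
Qed.

Lemma add_col m n (M : 'M_(m, n)) (j k : 'I_n) q : j != k -> S q ->
  exists M', [/\ equiv_mx M M', forall x, M' x k = M x k + M x j * q
    & forall x y, y != k -> M' x y = M x y].
Proof.
move=> njk Sq; exists (M *m (1%:M + q *: delta_mx j k)); split.
- by apply: equiv_mx_col; left; exists j, k, q.
- by move=> x; rewrite mulmxDr mulmx1 mxE mulmx_scale_delta eqxx.
- by move=> x y /negPf nyk; rewrite mulmxDr mulmx1 mxE mulmx_scale_delta nyk addr0.
Qed.

Lemma add_row m n (M : 'M_(m, n)) (i k : 'I_m) q : k != i -> S q ->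
  exists M', [/\ equiv_mx M M', forall y, M' k y = M k y + q * M i y
    & forall x y, x != k -> M' x y = M x y].
Proof.
move=> nki Sq; exists ((1%:M + q *: delta_mx k i) *m M); split.
- by apply: equiv_mx_row; left; exists k, i, q.
- by move=> y; rewrite mulmxDl mul1mx mxE scale_delta_mulmx eqxx.
- by move=> x y /negPf nxk; rewrite mulmxDl mul1mx mxE scale_delta_mulmx nxk addr0.
Qed.

Section MinimalPivot.
Variables (m n : nat) (M : 'M[A]_(m, n)) (k : nat).
Hypothesis SM : mx_in S M.
Hypothesis k_min : forall M', equiv_mx M M' -> forall i j,
  M' i j != 0 -> (k <= size_of (M' i j))%N.

(** A non-zero remainder would be an entry of a matrix equivalent to [M], of size below the minimum
    [k]. *)
Lemma pivot_divl M' i j l : equiv_mx M M' -> j != l ->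
  M' i j != 0 -> size_of (M' i j) = k -> exists2 q, S q & M' i l = M' i j * q.
Proof.
move=> MM' njl nz szk; have SM' := equiv_mx_in MM' SM.
have [q [Sq qP]] := euclid_divl hE (SM' i j) (SM' i l) nz.
exists q => //; apply/eqP; rewrite -subr_eq0; apply: contraT => nz'.
have [M2 [M'M2 M2l _]] := add_col M' njl (subN hS Sq).
have e : M2 i l = M' i l - M' i j * q by rewrite M2l mulrN.
have := k_min (equiv_mx_trans MM' M'M2) (i := i) (j := l); rewrite e => /(_ nz').
by case: qP => [/eqP|ltq]; rewrite ?(negPf nz') // leqNgt -szk ltq.
Qed.

Lemma pivot_divr M' i j l : equiv_mx M M' -> i != l ->
  M' i j != 0 -> size_of (M' i j) = k -> exists2 q, S q & M' l j = q * M' i j.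
Proof.
move=> MM' nil nz szk; have SM' := equiv_mx_in MM' SM.
have [q [Sq qP]] := euclid_divr hE (SM' i j) (SM' l j) nz.
exists q => //; apply/eqP; rewrite -subr_eq0; apply: contraT => nz'.
rewrite eq_sym in nil.
have [M2 [M'M2 M2l _]] := add_row M' nil (subN hS Sq).
have e : M2 l j = M' l j - q * M' i j by rewrite M2l mulNr.
have := k_min (equiv_mx_trans MM' M'M2) (i := l) (j := j); rewrite e => /(_ nz').
by case: qP => [/eqP|ltq]; rewrite ?(negPf nz') // leqNgt -szk ltq.
Qed.

End MinimalPivot.

(** The size is minimised over all equivalent matrices at once, which replaces the Euclidean loop.
    Moving the pivot to the corner and normalising it by a unit keep its size, hence its
    minimality. *)
Lemma pivot_exists m n (M : 'M[A]_(1 + m, 1 + n)) : mx_in S M -> M != 0 ->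
  exists M' k, [/\ equiv_mx M M', M' 0 0 != 0, size_of (M' 0 0) = k, nrm (M' 0 0) &
    forall M2, equiv_mx M M2 -> forall i j, M2 i j != 0 -> (k <= size_of (M2 i j))%N].
Proof.
move=> SM nzM.
have [k [[M1 [i [j [MM1 nz1 sz1]]]] kmin]] : exists k,
   (exists M' i j, [/\ equiv_mx M M', M' i j != 0 & size_of (M' i j) = k]) /\
   (forall l, (exists M' i j, [/\ equiv_mx M M', M' i j != 0 & size_of (M' i j) = l])
     -> (k <= l)%N).
  apply: ex_least.
  have [i [j nz]] : exists i j, M i j != 0.
    apply: NNPP => H; case/negP: nzM; apply/eqP/matrixP=> i j; rewrite mxE.
    by apply/eqP; apply: contraT => nz; case: H; exists i, j.
  by exists (size_of (M i j)), M, i, j; split=> //; apply: equiv_mx_refl.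
have {}kmin M2 : equiv_mx M M2 -> forall i j, M2 i j != 0 -> (k <= size_of (M2 i j))%N.
  by move=> MM2 x y nz; apply: kmin; exists M2, x, y.
pose M2 := tperm_mx 0 i *m M1 *m tperm_mx 0 j.
have MM2 : equiv_mx M M2.
  apply: (equiv_mx_trans MM1); apply: (@equiv_mx_trans _ _ _ (tperm_mx 0 i *m M1)).
    by apply: equiv_mx_row; right; left; exists 0, i.
  by apply: equiv_mx_col; right; left; exists 0, j.
have e2 : M2 0 0 = M1 i j by rewrite /M2 -xrowE -xcolE !mxE !tpermL.
have SM2 := equiv_mx_in MM2 SM.
have nz2 : M2 0 0 != 0 by rewrite e2.
have [u [Uu nu szu]] := euclid_nrm hE (SM2 0 0) nz2.
pose E : 'M[A]_(1 + n) := 1%:M + (u - 1) *: delta_mx 0 0.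
have e3 : (M2 *m E) 0 0 = M2 0 0 * u.
  by rewrite mulmxDr mulmx1 mxE mulmx_scale_delta eqxx mulr1n mulrBr mulr1 addrC subrK.
exists (M2 *m E), k; rewrite e3 szu e2; split=> //; last by rewrite -e2.
- by apply: (equiv_mx_trans MM2); apply: equiv_mx_col; right; right; exists 0, u.
- apply: contra_neq nz2; have [_ [w [_ uw _]]] := subU hS Uu; rewrite e2.
  by move/(congr1 ( *%R^~ w)); rewrite -mulrA uw mulr1 mul0r.
Qed.

Lemma pivot_clear m n (M : 'M[A]_(1 + m, 1 + n)) k : mx_in S M ->
  (forall M2, equiv_mx M M2 -> forall i j, M2 i j != 0 -> (k <= size_of (M2 i j))%N) ->
  M 0 0 != 0 -> size_of (M 0 0) = k ->
  exists2 B, equiv_mx M (block_mx (M 0 0)%:M 0 0 B) & mx_in S B.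
Proof.
move=> SM kmin nz szk.
have step1 l : exists M', [/\ equiv_mx M M', M' 0 0 = M 0 0 &
    forall j : 'I_(1 + n), (0 < j <= l)%N -> M' 0 j = 0].
  elim: l => [|l [M1 [MM1 M100 M1l]]].
    by exists M; split=> [||j]; [exact: equiv_mx_refl | | case: (j : nat)].
  have [lt_ln|le_nl] := ltnP l n; last first.
    exists M1; split=> // j /andP[j0 _]; apply: M1l; rewrite j0 -ltnS.
    by rewrite (leq_trans (ltn_ord j)).
  have lt_l1 : (l.+1 < 1 + n)%N by [].
  pose j1 : 'I_(1 + n) := Ordinal lt_l1.
  have nj1 : 0 != j1 by [].
  have [||q Sq eq1] := pivot_divl SM kmin (i := 0) MM1 nj1; rewrite ?M100 //.
  have [M2 [M1M2 M2j M2n]] := add_col M1 nj1 (subN hS Sq).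
  exists M2; split; first exact: equiv_mx_trans M1M2.
    by rewrite M2n.
  move=> j; have [->|nj] := eqVneq j j1; first by rewrite M2j eq1 M100 mulrN subrr.
  move=> /andP[j0]; rewrite leq_eqVlt ltnS M2n //; case/orP => [/eqP ej|lej].
    by case/eqP: nj; apply: val_inj.
  by apply: M1l; rewrite j0.
have [M1 [MM1 M100 M1r]] := step1 n.
(* Clearing the first column changes only rows other than the first, so the first row stays
   cleared. *)
have step2 l : exists M', [/\ equiv_mx M M', M' 0 0 = M 0 0,
    forall j : 'I_(1 + n), (0 < j)%N -> M' 0 j = 0 &
    forall i : 'I_(1 + m), (0 < i <= l)%N -> M' i 0 = 0].
  elim: l => [|l [M2 [MM2 M200 M2r M2l]]].
    exists M1; split=> // [j j0|i]; last by case: (i : nat).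
    by apply: M1r; rewrite j0 -ltnS ltn_ord.
  have [lt_ln|le_nl] := ltnP l m; last first.
    exists M2; split=> // j /andP[j0 _]; apply: M2l; rewrite j0 -ltnS.
    by rewrite (leq_trans (ltn_ord j)).
  have lt_l1 : (l.+1 < 1 + m)%N by [].
  pose i1 : 'I_(1 + m) := Ordinal lt_l1.
  have ni1 : 0 != i1 by [].
  have [||q Sq eq1] := pivot_divr SM kmin (j := 0) MM2 ni1; rewrite ?M200 //.
  rewrite eq_sym in ni1.
  have [M3 [M2M3 M3i M3n]] := add_row M2 ni1 (subN hS Sq).
  exists M3; split; first exact: equiv_mx_trans M2M3.
  - by rewrite M3n // eq_sym.
  - by move=> j j0; rewrite M3n ?M2r // eq_sym.
  move=> i; have [->|nj] := eqVneq i i1; first by rewrite M3i eq1 M200 mulNr subrr.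
  move=> /andP[j0]; rewrite leq_eqVlt ltnS M3n //; case/orP => [/eqP ej|lej].
    by case/eqP: nj; apply: val_inj.
  by apply: M2l; rewrite j0.
have [M2 [MM2 M200 M2r M2c]] := step2 m.
have SM2 := equiv_mx_in MM2 SM.
exists (drsubmx M2); last by move=> i j; rewrite !mxE.
suff <- : M2 = block_mx (M 0 0)%:M 0 0 (drsubmx M2) by [].
rewrite -{1}(submxK M2); congr block_mx.
- by apply/matrixP=> i j; rewrite !ord1 !mxE eqxx mulr1n -M200; congr (M2 _ _); apply: val_inj.
- apply/matrixP=> i j; rewrite !ord1 !mxE.
  have -> : lshift m 0 = 0 :> 'I_(1 + m) by apply: val_inj.
  exact: M2r.
- apply/matrixP=> i j; rewrite !ord1 !mxE.
  have -> : lshift n 0 = 0 :> 'I_(1 + n) by apply: val_inj.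
  by apply: M2c; rewrite /= add1n ltn_ord.
Qed.

Definition both_divides (a b : A) := (exists c, b = a * c) /\ (exists c, b = c * a).

Definition smith_form m n (M : 'M[A]_(m, n)) :=
  [/\ forall (i : 'I_m) (j : 'I_n), (i : nat) != j -> M i j = 0,
      forall (i : 'I_m) (j : 'I_n), (i : nat) = j -> M i j = 0 \/ nrm (M i j) &
      forall (i i' : 'I_m) (j j' : 'I_n), (i : nat) = j -> (i' : nat) = j' ->
        (i' : nat) = i.+1 -> both_divides (M i j) (M i' j')].

(* Divisibility of consecutive diagonal entries is inherited from the minimality
   of the pivot among all equivalent matrices: after adding the second row
   (column) to the first, the pivot must still divide its whole row (column). *)
Theorem smith m n (M : 'M[A]_(m, n)) : mx_in S M ->
  exists2 M', equiv_mx M M' & smith_form M'.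
Proof.
elim: m n M => [|m IHm] n M SM; first by exists M; [exact: equiv_mx_refl | split; case].
case: n M SM => [|n] M SM.
  by exists M; [exact: equiv_mx_refl | split=> [i|i|i i'] []].
have [M0|nzM] := eqVneq M 0.
  exists M; first exact: equiv_mx_refl.
  rewrite M0; split=> [i j _|i j _|i i' j j' _ _ _]; rewrite !mxE //; first by left.
  by split; exists 0; rewrite mulr0.
have [M1 [k [MM1 nz1 sz1 nrm1 kmin]]] := @pivot_exists m n M SM nzM.
have SM1 := equiv_mx_in MM1 SM.
have kmin1 M2 : equiv_mx M1 M2 -> forall i j, M2 i j != 0 -> (k <= size_of (M2 i j))%N.
  by move=> M12; apply: kmin; apply: equiv_mx_trans M12.
have [B M1B SB] := @pivot_clear m n M1 k SM1 kmin1 nz1 sz1.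
have [B' [P [Q [EP EQ eB']]] [B'0 B'n B'd]] := IHm n B SB.
set a := M1 0 0 in nz1 sz1 nrm1 M1B.
pose M3 : 'M[A]_(1 + m, 1 + n) := block_mx a%:M 0 0 B'.
have MM3 : equiv_mx M M3.
  apply: (equiv_mx_trans MM1); apply: (equiv_mx_trans M1B).
  exists (block_mx 1%:M 0 0 P : 'M_(1 + m)), (block_mx 1%:M 0 0 Q : 'M_(1 + n)).
  split; [exact: elemprod_lift | exact: elemprod_lift |].
  by rewrite !mulmx_block !(mulmx0, mul0mx, addr0, add0r) mul1mx mulmx1 -eB'.
have M3S i j : M3 (rshift 1 i) (rshift 1 j) = B' i j by rewrite /M3 block_mxEdr.
have M300 : M3 0 0 = a.
  have -> : 0 = lshift m 0 :> 'I_(1 + m) by apply: val_inj.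
  have -> : 0 = lshift n 0 :> 'I_(1 + n) by apply: val_inj.
  by rewrite /M3 block_mxEul mxE.
have M30S j : M3 0 (rshift 1 j) = 0.
  have -> : 0 = lshift m 0 :> 'I_(1 + m) by apply: val_inj.
  by rewrite /M3 block_mxEur mxE.
have M3S0 i : M3 (rshift 1 i) 0 = 0.
  have -> : 0 = lshift n 0 :> 'I_(1 + n) by apply: val_inj.
  by rewrite /M3 block_mxEdl mxE.
have ordP p (x : 'I_(1 + p)) : x = 0 \/ exists y, x = rshift 1 y.
  rewrite -(splitK x); case: (split x) => y /=; last by right; exists y.
  by left; apply: val_inj; rewrite /= ord1.
exists M3 => //; split.
- move=> i j; case: (ordP _ i) => [->|[i' ->]]; case: (ordP _ j) => [->|[j' ->]] //.
  by rewrite M3S /= !add1n eqSS; apply: B'0.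
- move=> i j; case: (ordP _ i) => [->|[i' ->]]; case: (ordP _ j) => [->|[j' ->]] //.
    by rewrite M300; right.
  by rewrite M3S /= !add1n => -[]; apply: B'n.
move=> i i' j j' eij eij' ei.
case: (ordP _ i') eij' ei => [->|[i2 ->]] // eij' ei.
case: (ordP _ j') eij' => [->|[j2 ->]] // eij'; rewrite M3S.
case: (ordP _ i) eij ei => [->|[i1 ->]]; case: (ordP _ j) => [->|[j1 ->]] // eij ei; last first.
  by rewrite M3S; move: eij eij' ei; rewrite /= !add1n => -[e1] [e2] [e3]; apply: B'd.
rewrite M300; split.
- have ni : 0 != rshift 1 i2 by [].
  have [M4 [M34 M40 _]] := add_row M3 ni (sub1 hS).
  have M400 : M4 0 0 = a by rewrite M40 M300 M3S0 mulr0 addr0.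
  have MM4 := equiv_mx_trans MM3 M34.
  have nj : 0 != rshift 1 j2 by [].
  have [||q _] := pivot_divl SM kmin (i := 0) MM4 nj; rewrite ?M400 //.
  by rewrite M40 M30S M3S add0r mul1r => ->; exists q.
- have nj : rshift 1 j2 != 0 by [].
  have [M4 [M34 M40 _]] := add_col M3 nj (sub1 hS).
  have M400 : M4 0 0 = a by rewrite M40 M300 M30S mul0r addr0.
  have MM4 := equiv_mx_trans MM3 M34.
  have ni : 0 != rshift 1 i2 by [].
  have [||q _] := pivot_divr SM kmin (j := 0) MM4 ni; rewrite ?M400 //.
  by rewrite M40 M3S0 M3S add0r mulr1 => ->; exists q.
Qed.

End Smith.

(** * Valuations of matrices, and the three Euclidean structures *)

Section Valuation.
Variables (R : unitRingType) (v : R -> int) (sigma : R).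
Hypothesis hL : complete_dv_skew_field v sigma.

Lemma div_mulVr (x : R) : x != 0 -> x^-1 * x = 1.
Proof. by move=> /(dv_division hL); apply: mulVr. Qed.

Lemma div_mulrV (x : R) : x != 0 -> x * x^-1 = 1.
Proof. by move=> /(dv_division hL); apply: mulrV. Qed.

Lemma div_neq0_mul (x y : R) : x != 0 -> y != 0 -> x * y != 0.
Proof.
move=> nx; apply: contra_neq => /(congr1 ( *%R x^-1)).
by rewrite mulrA div_mulVr // mul1r mulr0.
Qed.

Lemma div_mul_neq0 (x y : R) : x * y != 0 -> x != 0 /\ y != 0.
Proof. by move=> nxy; split; apply: contra_neq nxy => ->; rewrite (mul0r, mulr0). Qed.

Lemma v1 : v 1 = 0.
Proof.
have := dv_mul hL (oner_neq0 R) (oner_neq0 R).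
by rewrite mulr1 -{1}(addr0 (v 1)) => /addrI.
Qed.

Lemma vopp x : v (- x) = v x.
Proof.
have [->|nx] := eqVneq x 0; first by rewrite oppr0.
have nN1 : -1 != 0 :> R by rewrite oppr_eq0 oner_neq0.
have := dv_mul hL nN1 nN1; rewrite mulrNN mulr1 v1 => e.
rewrite -mulN1r (dv_mul hL nN1 nx); suff -> : v (-1) = 0 by rewrite add0r.
by apply/eqP; move/esym/eqP: e; rewrite -mulr2n mulrn_eq0.
Qed.

Lemma vinv x : x != 0 -> v x^-1 = - v x.
Proof.
move=> nx; have nxV : x^-1 != 0.
  by have /div_mul_neq0[] : x^-1 * x != 0 by rewrite div_mulVr // oner_neq0.
by apply/eqP; rewrite -addr_eq0 -(dv_mul hL) // div_mulVr // v1.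
Qed.

Lemma unif_neq0 n : sigma ^+ n != 0.
Proof.
elim: n => [|n IH]; first by rewrite expr0 oner_neq0.
by rewrite exprS; apply: div_neq0_mul IH; apply: dv_unif_neq0 hL.
Qed.

Lemma v_unif n : v (sigma ^+ n) = n%:Z.
Proof.
elim: n => [|n IH]; first by rewrite expr0 v1.
by rewrite exprS (dv_mul hL) ?unif_neq0 ?(dv_unif_neq0 hL) // IH (dv_unif hL) intS.
Qed.

Lemma vge0 k : vge v 0 k. Proof. by left. Qed.

Lemma vge_le x k l : l <= k -> vge v x k -> vge v x l.
Proof. by move=> lk [->|xk]; [left | right; apply: le_trans xk]. Qed.

Lemma vge_neq0 x k : x != 0 -> vge v x k -> k <= v x.
Proof. by move=> nx [/eqP|//]; rewrite (negPf nx). Qed.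

Lemma vge_add x y k : vge v x k -> vge v y k -> vge v (x + y) k.
Proof.
move=> xk yk.
have [->|nx] := eqVneq x 0; first by rewrite add0r.
have [->|ny] := eqVneq y 0; first by rewrite addr0.
have [->|nxy] := eqVneq (x + y) 0; first exact: vge0.
right; apply: le_trans (dv_add hL nx ny nxy).
by rewrite le_min !vge_neq0.
Qed.

Lemma vge_opp x k : vge v x k -> vge v (- x) k.
Proof. by case=> [->|xk]; [left; rewrite oppr0 | right; rewrite vopp]. Qed.

Lemma vge_sub x y k : vge v x k -> vge v y k -> vge v (x - y) k.
Proof. by move=> xk yk; apply/vge_add/vge_opp. Qed.

Lemma vge_mul x y k l : vge v x k -> vge v y l -> vge v (x * y) (k + l).
Proof.
move=> [->|xk]; first by rewrite mul0r; left.
move=> [->|yl]; first by rewrite mulr0; left.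
have [->|nx] := eqVneq x 0; first by rewrite mul0r; left.
have [->|ny] := eqVneq y 0; first by rewrite mulr0; left.
by right; rewrite (dv_mul hL) // lerD.
Qed.

Lemma vge_sum I (r : seq I) (P : pred I) (F : I -> R) k :
  (forall i, P i -> vge v (F i) k) -> vge v (\sum_(i <- r | P i) F i) k.
Proof.
move=> HF; apply: (big_ind (fun z => vge v z k)) => //; first exact: vge0.
by move=> x y; exact: vge_add.
Qed.

Lemma vge1 : vge v 1 0. Proof. by right; rewrite v1. Qed.

Lemma vge_bool (b : bool) : vge v b%:R 0.
Proof. by case: b; [exact: vge1 | exact: vge0]. Qed.

Lemma v_add_dominant x y : x != 0 -> vge v y (v x + 1) ->
  x + y != 0 /\ v (x + y) = v x.
Proof.
move=> nx yx; have nxy : x + y != 0.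
  rewrite addr_eq0; apply: contraTneq isT => xy; move: nx yx; rewrite xy vopp.
  rewrite oppr_eq0 => ny /(vge_neq0 ny).
  by rewrite -subr_ge0 opprD addrA subrr add0r.
split=> //; apply/eqP; rewrite eq_le; apply/andP; split; last first.
  apply: (vge_neq0 nxy); apply: vge_add; first by right.
  by apply: vge_le yx; rewrite lerDl.
rewrite leNgt; apply/negP; rewrite -lezD1 => lt.
have : vge v (x + y - y) (v x + 1) by apply: vge_sub => //; right.
rewrite addrK => /(vge_neq0 nx).
by rewrite -subr_ge0 opprD addrA subrr add0r.
Qed.

Definition vmx m n (M : 'M[R]_(m, n)) k := forall i j, vge v (M i j) k.

Lemma vmx_le m n (M : 'M_(m, n)) k l : l <= k -> vmx M k -> vmx M l.
Proof. by move=> lk Mk i j; apply: vge_le (Mk i j). Qed.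

Lemma vmx_mul m n p (M : 'M_(m, n)) (N : 'M_(n, p)) k l :
  vmx M k -> vmx N l -> vmx (M *m N) (k + l).
Proof. by move=> Mk Nl i j; rewrite mxE; apply: vge_sum => x _; apply: vge_mul. Qed.

Lemma vmx_sum m n I (r : seq I) (P : pred I) (F : I -> 'M_(m, n)) k :
  (forall i, P i -> vmx (F i) k) -> vmx (\sum_(i <- r | P i) F i) k.
Proof. by move=> HF i j; rewrite summxE; apply: vge_sum => x Px; apply: HF. Qed.

Lemma vmx_scalar n a k : vge v a k -> vmx (a%:M : 'M_n) k.
Proof. by move=> ak i j; rewrite mxE; case: eqP => _; [| exact: vge0]. Qed.

Lemma vmx_bounded m n (M : 'M_(m, n)) : exists k : nat, vmx M (- k%:Z).
Proof.
exists (\max_i \max_j `|v (M i j)|%N) => i j; right.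
rewrite lerNl; apply: le_trans (_ : `|v (M i j)|%N%:Z <= _).
  by rewrite abszE -normrN ler_norm.
rewrite lez_nat; apply: leq_trans (leq_bigmax i); exact: leq_bigmax j.
Qed.

(* By induction, every [n] steps gain one power of the uniformizer. *)
Lemma contraction m p n (X : nat -> 'M[R]_(m, p)) :
  (forall k c, (forall i, (i < n)%N -> vmx (X (k + i)%N) c) -> vmx (X (k + n)%N) (c + 1)) ->
  forall c : int, exists K, forall k, (K <= k)%N -> vmx (X k) c.
Proof.
move=> HX; have [b Hb] : exists b : nat, forall i, (i < n)%N -> vmx (X i) (- b%:Z).
  elim: n {HX} => [|n [b Hb]]; first by exists 0%N.
  have [b' Hb'] := vmx_bounded (X n); exists (maxn b b') => i.
  rewrite ltnS leq_eqVlt => /orP[/eqP ->|lt_in].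
    by apply: vmx_le Hb'; rewrite lerN2 lez_nat leq_maxr.
  by apply: vmx_le (Hb i lt_in); rewrite lerN2 lez_nat leq_maxl.
have base : forall k, vmx (X k) (- b%:Z).
  elim/ltn_ind=> k IH; have [/Hb//|le_nk] := ltnP k n.
  rewrite -(subnK le_nk); apply: (@vmx_le _ _ _ (- b%:Z + 1)); first by rewrite lerDl.
  apply: HX => i lt_in; apply: IH.
  by rewrite -{2}(subnK le_nk) ltn_add2l.
have gain : forall c : nat, forall k, (c * n <= k)%N -> vmx (X k) (- b%:Z + c%:Z).
  elim=> [|c IH] k; first by rewrite addr0.
  rewrite mulSn => le_k; have le_nk : (n <= k)%N by apply: leq_trans le_k; apply: leq_addr.
  rewrite -(subnK le_nk) intS (addrC 1) addrA; apply: HX => i _; apply: IH.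
  by rewrite (leq_trans _ (leq_addr _ _)) // leq_subRL.
move=> c; exists ((b + `|c|) * n)%N => k /gain; apply: vmx_le.
by rewrite PoszD addrA addNr add0r abszE ler_norm.
Qed.

Lemma subring_O : subring_with_units (inO v) (unitO v).
Proof.
split=> [|a b|a b|u [nu vu]]; first exact: vge1.
- exact: vge_sub.
- by move=> Oa Ob; rewrite /inO -(addr0 0); apply: vge_mul.
split; first by right; rewrite vu.
exists u^-1; rewrite div_mulrV // div_mulVr //; split=> //; split.
  by have /div_mul_neq0[] : u^-1 * u != 0 by rewrite div_mulVr // oner_neq0.
by rewrite vinv // vu oppr0.
Qed.

(** Of two non-zero elements one divides the other, so the division is either exact or has quotient
    [0]. On non-zero integral elements the absolute value in the size changes nothing. *)
Lemma euclidean_O : euclidean (inO v) (unitO v) (fun x => `|v x|%N)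
  (fun x => exists nu, x = sigma ^+ nu).
Proof.
have Oquot a b : a != 0 -> b != 0 -> v a <= v b -> inO v (a^-1 * b) /\ inO v (b * a^-1).
  move=> na nb ab; have va : vge v a^-1 (- v a) by right; rewrite vinv.
  have vb : vge v b (v b) by right.
  split.
    by apply: vge_le (vge_mul va vb); rewrite addrC subr_ge0.
  by apply: vge_le (vge_mul vb va); rewrite subr_ge0.
split=> [|a b Oa Ob na|a b Oa Ob na|a Oa na]; first exact: subring_O.
- have [->|nb] := eqVneq b 0; first by exists 0; rewrite mulr0 subr0; split; left.
  have [ab|ba] := leP (v a) (v b).
    exists (a^-1 * b); split; first by have [] := Oquot a b na nb ab.
    by left; rewrite mulrA div_mulrV // mul1r subrr.
  exists 0; rewrite mulr0 subr0; split; first exact: vge0.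
  by right; rewrite -ltz_nat !abszE !ger0_norm ?(vge_neq0 _ Oa) ?(vge_neq0 _ Ob).
- have [->|nb] := eqVneq b 0; first by exists 0; rewrite mul0r subr0; split; left.
  have [ab|ba] := leP (v a) (v b).
    exists (b * a^-1); split; first by have [] := Oquot a b na nb ab.
    by left; rewrite -mulrA div_mulVr // mulr1 subrr.
  exists 0; rewrite mul0r subr0; split; first exact: vge0.
  by right; rewrite -ltz_nat !abszE !ger0_norm ?(vge_neq0 _ Oa) ?(vge_neq0 _ Ob).
have va : v (sigma ^+ `|v a|) = v a.
  by rewrite v_unif abszE ger0_norm ?(vge_neq0 _ Oa).
have aV : a * (a^-1 * sigma ^+ `|v a|) = sigma ^+ `|v a|.
  by rewrite mulrA div_mulrV // mul1r.
exists (a^-1 * sigma ^+ `|v a|); rewrite aV va; split=> //; last by exists `|v a|%N.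
have naV : a^-1 != 0.
  by have /div_mul_neq0[] : a^-1 * a != 0 by rewrite div_mulVr // oner_neq0.
split; first exact: div_neq0_mul naV (unif_neq0 _).
by rewrite (dv_mul hL) ?unif_neq0 // va vinv // addNr.
Qed.

(** Every division is exact, so a constant size suffices. This instance diagonalises matrices over
    the skew field. *)
Lemma euclidean_division_ring :
  @euclidean R (fun=> True) (fun x => x != 0) (fun=> 0%N) (fun=> True).
Proof.
split=> [|a b _ _ na|a b _ _ na|a _ na].
- split=> // u nu; split=> //; exists u^-1.
  rewrite div_mulrV // div_mulVr //; split=> //.
  by have /div_mul_neq0[] : u^-1 * u != 0 by rewrite div_mulVr // oner_neq0.
- by exists (a^-1 * b); split=> //; left; rewrite mulrA div_mulrV // mul1r subrr.
- by exists (b * a^-1); split=> //; left; rewrite -mulrA div_mulVr // mulr1 subrr.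
by exists 1; split=> //; exact: oner_neq0.
Qed.

Lemma euclidean_poly :
  euclidean (@polyS R) (@polyU R) (fun p : {poly R} => size p) (fun p => p \is monic).
Proof.
have lcV (a : {poly R}) : a != 0 -> lead_coef a * (lead_coef a)^-1 = 1
    /\ (lead_coef a)^-1 * lead_coef a = 1.
  by rewrite -lead_coef_eq0 => na; rewrite div_mulrV // div_mulVr.
split=> [|a b _ _ na|a b _ _ na|a _ na].
- split=> // u [c [nc ->]]; split=> //; exists (c^-1)%:P.
  rewrite -!polyCM div_mulrV // div_mulVr //; split=> //; exists c^-1; split=> //.
  by have /div_mul_neq0[] : c^-1 * c != 0 by rewrite div_mulVr // oner_neq0.
- have [n] := ubnP (size b); elim: n b => // n IH b; rewrite ltnS => szb.
  have [lt_ba|le_ab] := ltnP (size b) (size a).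
    by exists 0; rewrite mulr0 subr0; split=> //; right.
  pose c := (lead_coef a)^-1 * lead_coef b; pose k := (size b - size a)%N.
  have sza : (0 < size a)%N by rewrite size_poly_gt0.
  have sz0 : (0 < size b)%N by apply: leq_trans le_ab.
  (* The subtracted term has the leading coefficient of [b] in the same degree, so the size drops by
     at least one. *)
  have szr : (size (b - a * (c%:P * 'X^k))%R <= (size b).-1)%N.
    apply/leq_sizeP => i le_i; rewrite mulrA coefB coefMXn coefMC.
    have -> : (i < k)%N = false.
      apply/negbTE; rewrite -leqNgt (leq_trans _ le_i) //.
      by rewrite -ltnS prednK // /k ltn_subrL sza sz0.
    move: le_i; rewrite leq_eqVlt => /orP[/eqP <-|lt_i].
      rewrite -lead_coefE; have -> : ((size b).-1 - k)%N = (size a).-1.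
        by rewrite /k -!subn1 -subnDA addnC subnDA subKn.
      by rewrite -lead_coefE /c mulrA (lcV _ na).1 mul1r subrr.
    rewrite prednK // in lt_i; rewrite nth_default // (nth_default _ (s := a)) ?mul0r ?subrr //.
    by rewrite leq_subRL ?(leq_trans (leq_subr _ _)) // /k subnK.
  have [|q [_ qP]] := IH _ (leq_ltn_trans szr _); first by rewrite prednK.
  exists (c%:P * 'X^k + q); split=> //.
  by rewrite mulrDr opprD addrA.
- have [n] := ubnP (size b); elim: n b => // n IH b; rewrite ltnS => szb.
  have [lt_ba|le_ab] := ltnP (size b) (size a).
    by exists 0; rewrite mul0r subr0; split=> //; right.
  pose c := lead_coef b * (lead_coef a)^-1; pose k := (size b - size a)%N.
  have sza : (0 < size a)%N by rewrite size_poly_gt0.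
  have sz0 : (0 < size b)%N by apply: leq_trans le_ab.
  have szr : (size (b - 'X^k * c%:P * a)%R <= (size b).-1)%N.
    apply/leq_sizeP => i le_i; rewrite -mulrA coefB coefXnM coefCM.
    have -> : (i < k)%N = false.
      apply/negbTE; rewrite -leqNgt (leq_trans _ le_i) //.
      by rewrite -ltnS prednK // /k ltn_subrL sza sz0.
    move: le_i; rewrite leq_eqVlt => /orP[/eqP <-|lt_i].
      rewrite -lead_coefE; have -> : ((size b).-1 - k)%N = (size a).-1.
        by rewrite /k -!subn1 -subnDA addnC subnDA subKn.
      by rewrite -lead_coefE /c -mulrA (lcV _ na).2 mulr1 subrr.
    rewrite prednK // in lt_i; rewrite nth_default // (nth_default _ (s := a)) ?mulr0 ?subrr //.
    by rewrite leq_subRL ?(leq_trans (leq_subr _ _)) // /k subnK.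
  have [|q [_ qP]] := IH _ (leq_ltn_trans szr _); first by rewrite prednK.
  exists ('X^k * c%:P + q); split=> //.
  by rewrite mulrDl opprD addrA.
have nlc : (lead_coef a)^-1 != 0.
  have [_ e] := lcV _ na.
  by have /div_mul_neq0[] : (lead_coef a)^-1 * lead_coef a != 0 by rewrite e oner_neq0.
(* The ambient ring type has no domain structure, so additivity of degrees needs this product to be
   explicitly non-zero. *)
have nlc1 : lead_coef a * lead_coef (lead_coef a)^-1%:P != 0.
  by rewrite lead_coefC (lcV _ na).1 oner_neq0.
exists (lead_coef a)^-1%:P; split; first by exists (lead_coef a)^-1.
- by rewrite monicE lead_coef_proper_mul // lead_coefC (lcV _ na).1.
- by rewrite size_proper_mul // size_polyC nlc addn1.
Qed.

End Valuation.

(** * Full rank modulo a power of the uniformizer as one-sided invertibility *)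

Lemma card_diag_le m n (a : 'I_m -> 'I_n -> bool) :
  (#|[set i : 'I_m | [exists j : 'I_n, (i == j :> nat) && a i j]]|
   <= #|[set j : 'I_n | [exists i : 'I_m, (i == j :> nat) && a i j]]|)%N.
Proof.
set T := [set i | _]; set K := [set j | _].
have [->|[i0]] := set_0Vmem T; first by rewrite cards0.
(* [h] preserves the underlying number only on [T]; elsewhere it may return the default [j0], which
   exists because [T] is non-empty. *)
rewrite inE => /existsP[j0 _]; pose h (i : 'I_m) : 'I_n := insubd j0 (i : nat).
have hT i : i \in T -> h i = i :> nat /\ h i \in K.
  rewrite !inE => /existsP[j /andP[/eqP eij aij]].
  have -> : h i = j by apply: val_inj; rewrite /h val_insubd eij ltn_ord.
  by split=> //; apply/existsP; exists i; rewrite eij eqxx.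
have hinj : {in T &, injective h}.
  by move=> i i' /hT[ei _] /hT[ei' _] e; apply: val_inj; rewrite /= -ei -ei' e.
rewrite -(card_in_imset hinj); apply/subset_leq_card/subsetP => j /imsetP[i iT ->].
by have [] := hT _ iT.
Qed.

(** [rank_mod] counts row indices, whereas a left inverse requires a suitable entry in every
    column. *)
Lemma card_diag m n (a : 'I_m -> 'I_n -> bool) :
  #|[set i : 'I_m | [exists j : 'I_n, (i == j :> nat) && a i j]]|
  = #|[set j : 'I_n | [exists i : 'I_m, (i == j :> nat) && a i j]]|.
Proof.
apply/eqP; rewrite eqn_leq card_diag_le /=.
suff sym p q (b : 'I_p -> 'I_q -> bool) :
    #|[set i : 'I_p | [exists j : 'I_q, (i == j :> nat) && b i j]]|
    = #|[set i : 'I_p | [exists j : 'I_q, (j == i :> nat) && b i j]]|.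
  by rewrite -sym [leqRHS]sym; apply: card_diag_le (fun j i => a i j).
by apply: eq_card => i; rewrite !inE; apply: eq_existsb => j; rewrite eq_sym.
Qed.

Section Rank.
Variables (R : unitRingType) (v : R -> int) (sigma : R).
Hypothesis hL : complete_dv_skew_field v sigma.

Lemma mulmx_eq1_diag n (M N : 'M[R]_n) :
  (forall i j : 'I_n, i != j -> M i j = 0) -> M *m N = 1%:M -> N *m M = 1%:M.
Proof.
move=> M0 MN.
have MNi i j : M i i * N i j = (i == j)%:R.
  have := congr1 (fun X : 'M_n => X i j) MN; rewrite !mxE => <-.
  rewrite (bigD1 i) //= big1 ?addr0 // => k nki.
  by rewrite M0 ?mul0r // eq_sym.
have nM i : M i i != 0.
  by have [] // := @div_mul_neq0 R (M i i) (N i i); rewrite MNi eqxx oner_neq0.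
have Nij i j : N i j = (M i i)^-1 * (i == j)%:R.
  by rewrite -MNi mulrA (div_mulVr hL) // mul1r.
apply/matrixP=> i j; rewrite !mxE (bigD1 i) //= big1 ?addr0 => [|k nki].
  rewrite Nij eqxx mulr1; have [<-|nij] := eqVneq i j; first by rewrite (div_mulVr hL).
  by rewrite (M0 _ _ nij) mulr0.
by rewrite Nij eq_sym (negPf nki) mulr0 mul0r.
Qed.

(** A diagonal form [P *m M *m Q] has right inverse [Q' *m N *m P'], which reduces the claim to
    diagonal [M]. *)
Lemma mulmx1C_div n (M N : 'M[R]_n) : M *m N = 1%:M -> N *m M = 1%:M.
Proof.
move=> MN; have hE := euclidean_division_ring hL.
have [M' [P [Q [EP EQ eM']]] [M'0 _ _]] := smith hE (M := M) (fun _ _ => I).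
have [_ [P' [_ PP' P'P]]] := elemprod_inv (euclid_sub hE) EP.
have [_ [Q' [_ QQ' Q'Q]]] := elemprod_inv (euclid_sub hE) EQ.
have : M' *m (Q' *m N *m P') = 1%:M.
  by rewrite eM' -!mulmxA (mulmxA Q) QQ' mul1mx (mulmxA M) MN mul1mx.
move/(mulmx_eq1_diag M'0); rewrite eM' !mulmxA -(mulmxA (Q' *m N)) P'P mulmx1.
move/(congr1 (fun X => Q *m X *m Q')).
by rewrite !mulmxA QQ' mul1mx -mulmxA QQ' !mulmx1 QQ'.
Qed.

(** Inverting the diagonal form gives a left inverse, and each [nu < s] bounds its entries by
    [1 - s]. Conversely a left inverse pairs each diagonal entry with one of opposite valuation.
    Integral base changes preserve the bound. *)
Lemma rank_mod_left m d s (B : 'M[R]_(m, d)) : mxO v B ->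
  rank_mod v sigma s B d <-> exists2 F : 'M[R]_(d, m), vmx v F (1 - s%:Z) & F *m B = 1%:M.
Proof.
move=> OB; have hE := euclidean_O hL; split.
- move=> [P [Q [EP [EQ]]]]; set A := P *m B *m Q => -[A0 [_]].
  rewrite (card_diag (fun i j => (A i j != 0) && (v (A i j) < s%:Z))).
  set K := [set j | _] => cK.
  have hK (j : 'I_d) : exists i : 'I_m, [/\ i = j :> nat, A i j != 0 & v (A i j) < s%:Z].
    have /eqP eK : K == setT by rewrite eqEcard subsetT cardsT card_ord cK leqnn.
    have : j \in K by rewrite eK.
    by rewrite inE => /existsP[i /and3P[/eqP eij nA vA]]; exists i.
  have [SP _] := elemprod_inv (euclid_sub hE) EP.
  have [SQ [Q' [_ QQ' _]]] := elemprod_inv (euclid_sub hE) EQ.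
  pose G : 'M_(d, m) := \matrix_(j, i) if (i == j :> nat) then (A i j)^-1 else 0.
  have GA : G *m A = 1%:M.
    apply/matrixP=> j j'; rewrite !mxE; have [i [eij nA _]] := hK j.
    rewrite (bigD1 i) //= big1 ?addr0 => [|k nki]; last first.
      rewrite mxE; case: eqP => [ekj|]; last by rewrite mul0r.
      by case/eqP: nki; apply: val_inj; rewrite /= ekj.
    rewrite mxE eij eqxx; have [<-|njj'] := eqVneq j j'; first by rewrite (div_mulVr hL).
    by rewrite (A0 i j') ?mulr0 // eij.
  have vG : vmx v G (1 - s%:Z).
    move=> j i; rewrite mxE; case: eqP => [eij|_]; last exact: vge0.
    have [i' [ei'j nA vA]] := hK j; have -> : i = i' by apply: val_inj; rewrite /= eij.
    by right; rewrite (vinv hL) //; lia.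
  exists (Q *m G *m P).
    rewrite -(addr0 (1 - _)); apply: (vmx_mul hL) => //.
    by rewrite -(add0r (1 - _)); apply: (vmx_mul hL).
  move: GA; rewrite /A !mulmxA => /(congr1 (fun X => Q *m X *m Q')).
  by rewrite !mulmxA -(mulmxA _ Q Q') QQ' !mulmx1 QQ'.
move=> [F vF FB].
have [A [P [Q [EP EQ eA]]] [A0 An _]] := smith hE (M := B) OB.
exists P, Q; rewrite -eA; do 4!split=> //.
have [_ [P' [SP' PP' P'P]]] := elemprod_inv (euclid_sub hE) EP.
have [_ [Q' [SQ' QQ' Q'Q]]] := elemprod_inv (euclid_sub hE) EQ.
pose H := Q' *m F *m P'.
have HA : H *m A = 1%:M.
  by rewrite /H eA !mulmxA -(mulmxA _ P') P'P mulmx1 -(mulmxA Q') FB mulmx1.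
have vH : vmx v H (1 - s%:Z).
  rewrite -(addr0 (1 - _)); apply: (vmx_mul hL) => //.
  by rewrite -(add0r (1 - _)); apply: (vmx_mul hL).
rewrite (card_diag (fun i j => (A i j != 0) && (v (A i j) < s%:Z))) -[RHS]card_ord -cardsT.
congr #|pred_of_set _|.
apply/setP=> j; rewrite !inE; apply/existsP.
have e1 : \sum_i H j i * A i j = 1.
  by have := congr1 (fun X : 'M_d => X j j) HA; rewrite !mxE eqxx.
have [i /eqP eij] : exists i : 'I_m, (i == j :> nat).
  apply/existsP; apply: contraT; rewrite negb_exists => /forallP nij.
  by move/eqP: e1; rewrite big1 ?(eq_sym 0) ?oner_eq0 // => i _; rewrite A0 ?mulr0.
exists i; rewrite eij eqxx /=.
have {}e1 : H j i * A i j = 1.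
  rewrite -e1 (bigD1 i) //= big1 ?addr0 // => k nki; rewrite A0 ?mulr0 // -eij.
  by apply: contra_neq nki => /= e; apply: val_inj.
have [nH nA] : H j i != 0 /\ A i j != 0 by apply: div_mul_neq0; rewrite e1 oner_neq0.
rewrite nA /=; have := vge_neq0 nH (vH j i).
have /eqP := dv_mul hL nH nA; rewrite e1 (v1 hL) eq_sym addr_eq0 => /eqP ->.
by rewrite lerNr opprB lerBrDr lezD1.
Qed.

(** Transposition does not reverse products over a non-commutative ring, so the mirror case has its
    own proof. *)
Lemma rank_mod_right d n s (B : 'M[R]_(d, n)) : mxO v B ->
  rank_mod v sigma s B d <-> exists2 F : 'M[R]_(n, d), vmx v F (1 - s%:Z) & B *m F = 1%:M.
Proof.
move=> OB; have hE := euclidean_O hL; split.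
- move=> [P [Q [EP [EQ]]]]; set A := P *m B *m Q => -[A0 [_]].
  set K := [set i | _] => cK.
  have hK (i : 'I_d) : exists j : 'I_n, [/\ i = j :> nat, A i j != 0 & v (A i j) < s%:Z].
    have /eqP eK : K == setT by rewrite eqEcard subsetT cardsT card_ord cK leqnn.
    have : i \in K by rewrite eK.
    by rewrite inE => /existsP[j /and3P[/eqP eij nA vA]]; exists j.
  have [SP [P' [_ PP' P'P]]] := elemprod_inv (euclid_sub hE) EP.
  have [SQ _] := elemprod_inv (euclid_sub hE) EQ.
  pose G : 'M_(n, d) := \matrix_(j, i) if (i == j :> nat) then (A i j)^-1 else 0.
  have AG : A *m G = 1%:M.
    apply/matrixP=> i i'; rewrite !mxE; have [j [eij nA _]] := hK i.
    rewrite (bigD1 j) //= big1 ?addr0 => [|k nkj]; last first.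
      rewrite A0 ?mul0r // eij eq_sym.
      by apply: contra_neq nkj => e; apply: val_inj.
    rewrite [G _ _]mxE -eij; have [<-|nii'] := eqVneq i i'; first by rewrite eqxx (div_mulrV hL).
    by rewrite eq_sym -[_ == _ :> nat]/(i == i') (negPf nii') mulr0.
  have vG : vmx v G (1 - s%:Z).
    move=> j i; rewrite mxE; case: eqP => [eij|_]; last exact: vge0.
    have [j' [eij' nA vA]] := hK i; have -> : j = j' by apply: val_inj; rewrite /= -eij.
    by right; rewrite (vinv hL) //; lia.
  exists (Q *m G *m P).
    rewrite -(addr0 (1 - _)); apply: (vmx_mul hL) => //.
    by rewrite -(add0r (1 - _)); apply: (vmx_mul hL).
  move: AG; rewrite /A => /(congr1 (fun X => P' *m X *m P)).
  by rewrite !mulmxA P'P mul1mx mulmx1 P'P.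
move=> [F vF BF].
have [A [P [Q [EP EQ eA]]] [A0 An _]] := smith hE (M := B) OB.
exists P, Q; rewrite -eA; do 4!split=> //.
have [_ [P' [SP' PP' P'P]]] := elemprod_inv (euclid_sub hE) EP.
have [_ [Q' [SQ' QQ' Q'Q]]] := elemprod_inv (euclid_sub hE) EQ.
pose H := Q' *m F *m P'.
have AH : A *m H = 1%:M.
  by rewrite /H eA !mulmxA -(mulmxA _ Q) QQ' mulmx1 -(mulmxA P) BF mulmx1.
have vH : vmx v H (1 - s%:Z).
  rewrite -(addr0 (1 - _)); apply: (vmx_mul hL) => //.
  by rewrite -(add0r (1 - _)); apply: (vmx_mul hL).
rewrite -[RHS]card_ord -cardsT.
congr #|pred_of_set _|.
apply/setP=> i; rewrite !inE; apply/existsP.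
have e1 : \sum_j A i j * H j i = 1.
  by have := congr1 (fun X : 'M_d => X i i) AH; rewrite !mxE eqxx.
have [j /eqP eij] : exists j : 'I_n, (i == j :> nat).
  apply/existsP; apply: contraT; rewrite negb_exists => /forallP nij.
  by move/eqP: e1; rewrite big1 ?(eq_sym 0) ?oner_eq0 // => j _; rewrite A0 ?mul0r.
exists j; rewrite eij eqxx /=.
have {}e1 : A i j * H j i = 1.
  rewrite -e1 (bigD1 j) //= big1 ?addr0 // => k nkj; rewrite A0 ?mul0r // eij eq_sym.
  by apply: contra_neq nkj => /= e; apply: val_inj.
have [nA nH] : A i j != 0 /\ H j i != 0 by apply: div_mul_neq0; rewrite e1 oner_neq0.
rewrite nA /=; have := vge_neq0 nH (vH j i).
have /eqP := dv_mul hL nA nH; rewrite e1 (v1 hL) eq_sym addrC addr_eq0 => /eqP ->.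
by rewrite lerNr opprB lerBrDr lezD1.
Qed.

(** Absorbing [sigma ^+ s] into the left inverse removes [s] from the criterion; only positivity of
    the valuation remains. *)
Lemma rank_mod_scale_left m d s (C : 'M[R]_(m, d)) : mxO v (sigma ^+ s *: C) ->
  rank_mod v sigma s (sigma ^+ s *: C) d
  <-> exists2 E : 'M[R]_(d, m), vmx v E 1 & E *m C = 1%:M.
Proof.
move=> OC; rewrite (rank_mod_left _ OC) -mul_scalar_mx.
have ns := unif_neq0 hL s; split=> [[F vF FC]|[E vE EC]].
- exists (F *m (sigma ^+ s)%:M); last by rewrite -mulmxA.
  rewrite -(subrK s%:Z 1); apply: (vmx_mul hL) => //; apply: vmx_scalar.
  by right; rewrite (v_unif hL).
- exists (E *m (sigma ^+ s)^-1%:M).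
    apply: (vmx_mul hL) => //; apply: vmx_scalar.
    by right; rewrite (vinv hL) // (v_unif hL).
  by rewrite mulmxA -(mulmxA E) -scalar_mxM (div_mulVr hL) // mulmx1.
Qed.

Lemma rank_mod_scale_right d n s (C : 'M[R]_(d, n)) : mxO v (sigma ^+ s *: C) ->
  rank_mod v sigma s (sigma ^+ s *: C) d
  <-> exists2 E : 'M[R]_(n, d), vmx v E 1 & C *m E = 1%:M.
Proof.
move=> OC; rewrite (rank_mod_right _ OC) -mul_scalar_mx.
have ns := unif_neq0 hL s; split=> [[F vF FC]|[E vE EC]].
- exists (F *m (sigma ^+ s)%:M).
    rewrite -(subrK s%:Z 1); apply: (vmx_mul hL) => //; apply: vmx_scalar.
    by right; rewrite (v_unif hL).
  (* As [sigma] need not be central, conjugation carries the factor [sigma ^+ s] from the far left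
     to the far right. *)
  move/(congr1 (fun X => (sigma ^+ s)^-1%:M *m X *m (sigma ^+ s)%:M)): FC.
  rewrite !mulmxA -scalar_mxM (div_mulVr hL) // mul1mx mulmx1 => ->.
  by rewrite -scalar_mxM (div_mulVr hL).
- exists (E *m (sigma ^+ s)^-1%:M).
    apply: (vmx_mul hL) => //; apply: vmx_scalar.
    by right; rewrite (vinv hL) // (v_unif hL).
  by rewrite mulmxA -(mulmxA _ C) EC mulmx1 -scalar_mxM (div_mulrV hL).
Qed.

Section Powers.
Variables (d : nat) (D : 'M[R]_d) (n s : nat).
Hypothesis hs : is_sn v D n s.

Lemma scaled_power_O k : (1 <= k <= n)%N -> mxO v (sigma ^+ s *: D ^+ k).
Proof.
move=> hk i j; rewrite mxE /inO -(subrr s%:Z); apply: (vge_mul hL).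
  by right; rewrite (v_unif hL).
by case: hs => + _; apply.
Qed.

Lemma rank_mod_power : (0 < n)%N ->
  rank_mod v sigma s (sigma ^+ s *: D ^+ n) d
  <-> exists2 E : 'M[R]_d, vmx v E 1 & E *m D ^+ n = 1%:M.
Proof. by move=> n0; apply/rank_mod_scale_left/scaled_power_O; rewrite n0 leqnn. Qed.

Lemma rank_mod_mxcol :
  rank_mod v sigma s
    (\mxcol_(k < n) (sigma ^+ s *: D ^+ k.+1) : 'M[R]_(\sum_(k < n) d, d)) d
  <-> exists2 E : 'I_n -> 'M[R]_d, (forall k, vmx v (E k) 1)
      & \sum_(k < n) E k *m D ^+ k.+1 = 1%:M.
Proof.
have -> : \mxcol_(k < n) (sigma ^+ s *: D ^+ k.+1)
    = sigma ^+ s *: (\mxcol_(k < n) D ^+ k.+1) :> 'M[R]_(\sum_(k < n) d, d).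
  by apply/matrixP=> i j; rewrite !mxE.
rewrite rank_mod_scale_left; last first.
  move=> i j; have := scaled_power_O (k := (tagnat.sig1 i).+1) _ (tagnat.sig2 i) j.
  by rewrite !mxE ltn_ord => /(_ isT).
split=> [[E vE eE]|[E vE eE]].
- exists (submxrow E) => [k i j|]; first by rewrite mxE; apply: vE.
  by rewrite -mul_mxrow_mxcol submxrowK.
- exists (\mxrow_(k < n) E k); last by rewrite mul_mxrow_mxcol.
  by move=> i j; rewrite mxE; apply: vE.
Qed.

Lemma rank_mod_mxrow :
  rank_mod v sigma s
    (\mxrow_(k < n) (sigma ^+ s *: D ^+ k.+1) : 'M[R]_(d, \sum_(k < n) d)) d
  <-> exists2 E : 'I_n -> 'M[R]_d, (forall k, vmx v (E k) 1)
      & \sum_(k < n) D ^+ k.+1 *m E k = 1%:M.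
Proof.
have -> : \mxrow_(k < n) (sigma ^+ s *: D ^+ k.+1)
    = sigma ^+ s *: (\mxrow_(k < n) D ^+ k.+1) :> 'M[R]_(d, \sum_(k < n) d).
  by apply/matrixP=> i j; rewrite !mxE.
rewrite rank_mod_scale_right; last first.
  move=> i j; have := scaled_power_O (k := (tagnat.sig1 j).+1) _ i (tagnat.sig2 j).
  by rewrite !mxE ltn_ord => /(_ isT).
split=> [[E vE eE]|[E vE eE]].
- exists (submxcol E) => [k i j|]; first by rewrite mxE; apply: vE.
  by rewrite -mul_mxrow_mxcol submxcolK.
- exists (\mxcol_(k < n) E k); last by rewrite mul_mxrow_mxcol.
  by move=> i j; rewrite mxE; apply: vE.
Qed.

End Powers.

End Rank.

(** * Gauss valuation and Newton polygons over a skew field *)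

Section Polynomials.
Variables (R : unitRingType) (v : R -> int) (sigma : R).
Hypothesis hL : complete_dv_skew_field v sigma.

(** A lower bound for the Gauss valuation, the least valuation of a coefficient. *)
Definition pvge (p : {poly R}) k := forall i, vge v p`_i k.

Definition pvmx m n (M : 'M[{poly R}]_(m, n)) k := forall i j, pvge (M i j) k.

Lemma pvge_mul p q k l : pvge p k -> pvge q l -> pvge (p * q) (k + l).
Proof. by move=> pk ql i; rewrite coefM; apply: (vge_sum hL) => j _; apply: (vge_mul hL). Qed.

Lemma pvge_bound (p : {poly R}) : pvge p (- (\max_(i < size p) `|v p`_i|%N)%:Z).
Proof.
move=> i; have [lt_i|le_i] := ltnP i (size p); last by rewrite nth_default //; left.
right; rewrite lerNl; apply: le_trans (_ : `|v p`_i|%N%:Z <= _).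
  by rewrite abszE -normrN ler_norm.
by rewrite lez_nat; apply: (leq_bigmax (Ordinal lt_i)).
Qed.

Lemma pvmx_mul m n p (M : 'M_(m, n)) (N : 'M_(n, p)) k l :
  pvmx M k -> pvmx N l -> pvmx (M *m N) (k + l).
Proof.
move=> Mk Nl i j x; rewrite mxE coef_sum; apply: (vge_sum hL) => y _.
exact: pvge_mul.
Qed.

(** This bounds the valuation lost when multiplying by a base change over polynomials. *)
Lemma pvmx_bounded m n (M : 'M[{poly R}]_(m, n)) : exists k : nat, pvmx M (- k%:Z).
Proof.
exists (\max_i \max_j \max_(l < size (M i j)) `|v (M i j)`_l|%N) => i j l.
apply: vge_le (pvge_bound (M i j) l).
rewrite lerN2 lez_nat; apply: leq_trans (leq_bigmax i).
exact: (leq_bigmax (F := fun j => \max_(l < size (M i j)) `|v (M i j)`_l|%N) j).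
Qed.

Definition const_dominant (f : {poly R}) :=
  f`_0 != 0 /\ forall i, (0 < i)%N -> vge v f`_i (v f`_0 + 1).

(** The index [r] is where the non-positive slopes of the Newton polygon end; [r = 0] characterises
    [const_dominant]. *)
Lemma last_minimum (f : {poly R}) : f != 0 -> exists r, [/\ f`_r != 0,
  forall i, vge v f`_i (v f`_r) & forall i, (r < i)%N -> vge v f`_i (v f`_r + 1)].
Proof.
move=> nf.
suff H n : (exists2 i, (i < n)%N & f`_i != 0) -> exists r, [/\ f`_r != 0,
    forall i, (i < n)%N -> vge v f`_i (v f`_r)
    & forall i, (i < n)%N -> (r < i)%N -> vge v f`_i (v f`_r + 1)].
  have [|r [nr r1 r2]] := H (size f).
    exists (size f).-1; first by rewrite prednK // size_poly_gt0.
    by rewrite -lead_coefE lead_coef_eq0.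
  exists r; split=> // i; have [lt_i|le_i] := ltnP i (size f).
  - exact: r1.
  - by rewrite nth_default //; left.
  - exact: r2.
  - by rewrite nth_default //; left.
elim: n => [[] //|n IH [i0 lt_i0 ni0]].
case: (classic (exists2 i, (i < n)%N & f`_i != 0)) => [/IH[r [nr r1 r2]]|H]; last first.
  have z i : (i < n)%N -> f`_i = 0.
    by move=> lt_i; apply/eqP; apply: contraT => ni; case: H; exists i.
  have ei : i0 = n.
    by apply/eqP; move: lt_i0; rewrite ltnS leq_eqVlt => /orP[//|/z/eqP]; rewrite (negPf ni0).
  exists n; rewrite -ei in lt_i0 z *; split=> // i.
    by rewrite ltnS leq_eqVlt => /orP[/eqP ->|/z ->]; [right | left].
  by rewrite ltnS leqNgt => /negPf ->.
case: (classic (vge v f`_n (v f`_r + 1))) => [Hn|Hn].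
  exists r; split=> // i; rewrite ltnS leq_eqVlt => /orP[/eqP ->|lt_i].
  - by apply: vge_le Hn; rewrite lerDl.
  - exact: r1.
  - by [].
  - exact: r2.
have nn : f`_n != 0 by apply: contra_not_neq Hn => ->; left.
have vn : v f`_n <= v f`_r.
  by rewrite leNgt; apply/negP => lt; apply: Hn; right; rewrite lezD1.
exists n; split=> // i; last by rewrite ltnS leqNgt => /negPf ->.
rewrite ltnS leq_eqVlt => /orP[/eqP ->|lt_i]; first by right.
by apply: vge_le vn (r1 i lt_i).
Qed.

(* Gauss' lemma: the last indices of minimal valuation of [f] and [g] add up
   to that of [f * g]. *)
Lemma const_dominant_mul f g : const_dominant (f * g) -> const_dominant f /\ const_dominant g.
Proof.
move=> [n0 fg].
have nfg : f * g != 0 by apply: contra_neq n0 => ->; rewrite coef0.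
have nf : f != 0 by apply: contra_neq nfg => ->; rewrite mul0r.
have ng : g != 0 by apply: contra_neq nfg => ->; rewrite mulr0.
have [r [nr r1 r2]] := last_minimum nf; have [s [ns s1 s2]] := last_minimum ng.
have nrs := div_neq0_mul hL nr ns; have vrs := dv_mul hL nr ns.
have [nc vc] : (f * g)`_(r + s) != 0 /\ v (f * g)`_(r + s) = v f`_r + v g`_s.
  have lt_r : (r < (r + s).+1)%N by rewrite ltnS leq_addr.
  rewrite coefM (bigD1 (Ordinal lt_r)) //= addKn -vrs.
  apply: (v_add_dominant hL) => //; rewrite vrs; apply: (vge_sum hL) => -[i /= lt_i].
  (* In any other term the index in [g] exceeds [s], or the index in [f] exceeds [r], so one factor
     has valuation above its minimum. *)
  rewrite -val_eqE /= => nir; have [lt_ir|le_ri] := ltnP i r.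
    by rewrite -addrA; apply: (vge_mul hL) (r1 i) (s2 _ _); lia.
  rewrite addrAC; apply: (vge_mul hL) (r2 i _) (s1 _).
  by rewrite ltn_neqAle eq_sym nir.
have v0 : vge v (f * g)`_0 (v f`_r + v g`_s) by rewrite coef0M; apply: (vge_mul hL).
have rs0 : (r + s == 0)%N.
  rewrite eqn0Ngt; apply/negP => /fg /(vge_neq0 nc); rewrite vc => le.
  by have := le_trans le (vge_neq0 n0 v0); rewrite gerDl.
move: rs0; rewrite addn_eq0 => /andP[/eqP r0 /eqP s0].
by move: nr ns r2 s2; rewrite r0 s0.
Qed.

Lemma np_slopes_pos_dominant (f : {poly R}) : np_slopes_pos v f <-> const_dominant f.
Proof.
split=> [[n0 pos]|[n0 dom]].
- split=> // i0 i00; have [->|ni0] := eqVneq f`_i0 0; first by left.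
  have lt_i0 : (i0 < size f)%N.
    by rewrite ltnNge; apply: contra ni0 => le; rewrite nth_default.
  pose P := [pred i : 'I_(size f) | (0 < i)%N && (f`_i != 0)].
  have Pi0 : P (Ordinal lt_i0) by rewrite /= i00.
  (* The least slope seen from index [0] belongs to an edge, so it is positive, and it bounds all
     other slopes from [0]. *)
  have [j /andP[/= j0 nj] jmin] := arg_minP (fun i : 'I_(size f) => np_slope v f 0 i) Pi0.
  have sl k : (0 < k)%N -> np_slope v f 0 k * k%:R = (v f`_k - v f`_0)%:~R.
    by move=> k0; rewrite /np_slope subn0 divfK // pnatr_eq0 -lt0n.
  have pj : 0 < np_slope v f 0 j.
    apply: pos; split=> //; split=> //; split=> // k nk.
    have [->|k0] := posnP k; first by rewrite subrr mulr0 addr0.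
    have lt_k : (k < size f)%N.
      by rewrite ltnNge; apply: contra nk => le; rewrite nth_default.
    have := jmin (Ordinal lt_k); rewrite /= k0 nk => /(_ isT) le.
    rewrite subr0 -lerBrDl -intrB -sl //; apply: ler_wpM2r le; exact: ler0n.
  have := jmin (Ordinal lt_i0) Pi0 => /= /(lt_le_trans pj) pi.
  have : 0 < np_slope v f 0 i0 * i0%:R by rewrite mulr_gt0 // ltr0n.
  by rewrite sl // ltr0z subr_gt0 -lezD1; right.
split=> // i j [lt_ij [ni [nj edge]]].
have domn k : (0 < k)%N -> f`_k != 0 -> v f`_0 + 1 <= v f`_k.
  by move=> k0 nk; apply: vge_neq0 (dom k k0).
case: i => [|i] in lt_ij ni edge *.
  rewrite /np_slope divr_gt0 ?ltr0n ?subn_gt0 // ltr0z.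
  by rewrite subr_gt0 -lezD1 domn.
(* At index [0] the line of the edge is at most [v f_0], which is strictly below its height at index
   [i.+1]; hence the line rises. *)
have := edge 0 n0; rewrite sub0r mulrNz mulrN lerBlDr addrC -lerBlDr -intrB => le.
have lt := domn _ (ltn0Sn i) ni.
have : 0 < np_slope v f i.+1 j * (i.+1%:Z)%:~R by apply: lt_le_trans le; rewrite ltr0z subr_gt0 -lezD1.
by rewrite pmulr_lgt0 // ltr0z.
Qed.

End Polynomials.

(** * Topologically nilpotent inverses and invariant factors *)

Section Expanding.
Variables (R : unitRingType) (v : R -> int) (sigma : R).
Hypothesis hL : complete_dv_skew_field v sigma.
Variables (d : nat) (D : 'M[R]_d).

(** This condition is symmetric in left and right, which lets it mediate between the one-sided
    relations. *)
Definition expanding := exists N : 'M[R]_d,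
  [/\ D * N = 1, N * D = 1 &
      forall c : int, exists K, forall k, (K <= k)%N -> vmx v (N ^+ k) c].

Lemma expr_inv_cancel (M N : 'M[R]_d) a b : M * N = 1 -> N * M = 1 -> (a <= b)%N ->
  M ^+ a * N ^+ b = N ^+ (b - a) /\ N ^+ b * M ^+ a = N ^+ (b - a).
Proof.
move=> MN NM le_ab.
have com : GRing.comm M N by rewrite /GRing.comm MN NM.
split.
  by rewrite -{1}(subnKC le_ab) exprD mulrA -exprMn_comm // MN expr1n mul1r.
by rewrite -{1}(subnK le_ab) exprD -mulrA -exprMn_comm // NM expr1n mulr1.
Qed.

(** Multiplying the relation by [N ^+ (k + n)] expresses this power through the [n] preceding ones,
    since the exponents of [D] run from [1] to [n]. Each coefficient gains one unit of valuation. *)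
Lemma expanding_left n (E : 'I_n -> 'M[R]_d) : (forall k, vmx v (E k) 1) ->
  \sum_(k < n) E k *m D ^+ k.+1 = 1%:M -> expanding.
Proof.
move=> vE eE; pose N := \sum_(k < n) E k * D ^+ k.
have ND : N * D = 1.
  by rewrite -[RHS]eE mulr_suml; apply: eq_bigr => k _; rewrite -mulrA -exprSr.
have DN : D * N = 1 by apply: (mulmx1C_div hL).
exists N; split=> //; apply: (contraction (X := fun k => N ^+ k) (n := n)) => k c Xc.
have -> : N ^+ (k + n) = \sum_(j < n) E j *m N ^+ (k + (n - j.+1)).
  rewrite -[LHS]mul1r -[X in X * _]eE mulr_suml; apply: eq_bigr => j _.
  have le_j : (j.+1 <= k + n)%N by rewrite (leq_trans (ltn_ord j)) // leq_addl.
  rewrite -[E j *m _]/(E j * _) -mulrA (expr_inv_cancel DN ND le_j).1.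
  by rewrite addnBA.
apply: (vmx_sum hL) => j _; rewrite addrC; apply: (vmx_mul hL) => //.
by apply: Xc; rewrite ltn_subrL (leq_ltn_trans _ (ltn_ord j)).
Qed.

Lemma expanding_right n (E : 'I_n -> 'M[R]_d) : (forall k, vmx v (E k) 1) ->
  \sum_(k < n) D ^+ k.+1 *m E k = 1%:M -> expanding.
Proof.
move=> vE eE; pose N := \sum_(k < n) D ^+ k * E k.
have DN : D * N = 1.
  by rewrite -[RHS]eE mulr_sumr; apply: eq_bigr => k _; rewrite mulrA -exprS.
have ND : N * D = 1 by apply: (mulmx1C_div hL).
exists N; split=> //; apply: (contraction (X := fun k => N ^+ k) (n := n)) => k c Xc.
have -> : N ^+ (k + n) = \sum_(j < n) N ^+ (k + (n - j.+1)) *m E j.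
  rewrite -[LHS]mulr1 -[X in _ * X]eE mulr_sumr; apply: eq_bigr => j _.
  have le_j : (j.+1 <= k + n)%N by rewrite (leq_trans (ltn_ord j)) // leq_addl.
  rewrite -[_ *m E j]/(_ * E j) mulrA (expr_inv_cancel DN ND le_j).2.
  by rewrite addnBA.
apply: (vmx_sum hL) => j _; apply: (vmx_mul hL) => //.
by apply: Xc; rewrite ltn_subrL (leq_ltn_trans _ (ltn_ord j)).
Qed.

Lemma expanding_power : expanding ->
  exists n (E : 'M[R]_d), [/\ (0 < n)%N, vmx v E 1, E * D ^+ n = 1 & D ^+ n * E = 1].
Proof.
move=> [N [DN ND HN]]; have [K HK] := HN 1.
(* The successor keeps the exponent positive when [K] is [0]. *)
exists K.+1, (N ^+ K.+1); split=> //; first exact: HK.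
- by rewrite (expr_inv_cancel DN ND (leqnn _)).2 subnn.
- by rewrite (expr_inv_cancel DN ND (leqnn _)).1 subnn.
Qed.

Definition diag_poly (h : 'I_d -> {poly R}) : 'M[{poly R}]_d :=
  \matrix_(i, j) if i == j then h i else 0.

Lemma diag_poly_mul h g : diag_poly h *m diag_poly g = diag_poly (fun i => h i * g i).
Proof.
apply/matrixP=> i j; rewrite !mxE (bigD1 i) //= big1 ?addr0 => [|k nki]; rewrite !mxE.
  by rewrite eqxx; case: eqP => // _; rewrite mulr0.
by rewrite eq_sym (negPf nki) mul0r.
Qed.

(** Only central scalars pass through the left factor; powers of the indeterminate do. *)
Lemma mulmx_scaleX m n p (M : 'M[{poly R}]_(m, n)) (N : 'M_(n, p)) k :
  M *m ('X^k *: N) = 'X^k *: (M *m N).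
Proof.
apply/matrixP=> i j; rewrite !mxE mulr_sumr; apply: eq_bigr => l _.
by rewrite !mxE !mulrA -(commr_polyXn (M i l)).
Qed.

(** [H] truncates, up to sign, the geometric series of the resolvent: [charmx D] times [N] is
    [T - 1] with [T = 'X *: N]. *)
Lemma charmx_geometric (N : 'M[R]_d) k : D * N = 1 ->
  exists H, charmx D *m H = 'X^k *: map_mx polyC (N ^+ k) - 1%:M.
Proof.
move=> DN; pose T : 'M[{poly R}]_d := 'X *: map_mx polyC N.
have -> : 'X^k *: map_mx polyC (N ^+ k) = T ^+ k.
  elim: k => [|k IH]; first by rewrite !expr0 scale1r -[RHS](map_mx1 (@polyC R)).
  rewrite [RHS]exprS -IH -[RHS]/(_ *m _) -scalemxAl mulmx_scaleX scalerA -exprS.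
  by rewrite -map_mxM -[N *m _]/(N * _) -(exprS N).
exists (map_mx polyC N *m \sum_(i < k) T ^+ i).
rewrite -[RHS]/(T ^+ k - 1) subrX1 mulmxA; congr (_ *m _).
by rewrite /charmx mulmxBl mul_scalar_mx -map_mxM -[D *m N]/(D * N) DN map_mx1.
Qed.

Lemma expanding_invariant_factors : expanding ->
  exists2 lam : 'I_d -> {poly R}, invariant_factors D lam
    & forall i, np_slopes_pos v (lam i).
Proof.
move=> [N [DN ND HN]]; have hE := euclidean_poly hL.
have [A [P [Q [EP EQ eA]]] [A0 An Ad]] := smith hE (M := charmx D) (fun _ _ => I).
have [_ [P' [_ PP' _]]] := elemprod_inv (euclid_sub hE) EP.
have [_ [Q' [_ QQ' _]]] := elemprod_inv (euclid_sub hE) EQ.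
have eAd : A = diag_poly (fun i => A i i).
  apply/matrixP=> i j; rewrite mxE; case: eqP => [->//|/eqP nij]; exact: A0.
have dom i : const_dominant v (A i i).
  have [b Pb] := pvmx_bounded v P; have [b' P'b'] := pvmx_bounded v P'.
  (* Conjugation by [P] loses at most [b + b']; the extra [1] leaves coefficients of positive
     valuation. *)
  have [K HK] := HN (b%:Z + b'%:Z + 1).
  have [H eH] := charmx_geometric K.+1 DN.
  have vN : pvmx v (map_mx polyC (N ^+ K.+1)) (b%:Z + b'%:Z + 1).
    move=> x y l; rewrite mxE coefC; case: eqP => _; last exact: vge0.
    by apply: HK; apply: leqnSn.
  have [Z [G [e vG]]] : exists Z G, A *m Z = 'X^(K.+1) *: G - 1%:M /\ pvmx v G 1.
    exists (Q' *m H *m P'), (P *m map_mx polyC (N ^+ K.+1) *m P'); split.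
      rewrite eA !mulmxA -(mulmxA _ Q) QQ' mulmx1 -(mulmxA P) eH mulmxBr mulmx1.
      by rewrite mulmxBl PP' mulmx_scaleX -scalemxAl.
    have := pvmx_mul hL (pvmx_mul hL Pb vN) P'b'.
    by have -> : - b%:Z + (b%:Z + b'%:Z + 1) - b'%:Z = 1 by lia.
  have := congr1 (fun X : 'M_d => X i i) e; rewrite {1}eAd.
  rewrite !mxE (bigD1 i) //= big1 ?addr0 => [|k nki]; last first.
    by rewrite mxE eq_sym (negPf nki) mul0r.
  rewrite mxE eqxx => ei; apply: (proj1 (const_dominant_mul hL (g := Z i i) _)).
  (* The exponent [K.+1] is positive, so the small part does not reach the constant coefficient,
     whose valuation is exactly [0]. *)
  rewrite ei; have c0 : ('X^(K.+1) * G i i - 1)`_0 = -1.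
    by rewrite coefB coefXnM coef1 sub0r.
  rewrite /const_dominant c0 oppr_eq0 oner_neq0 (vopp hL) (v1 hL) add0r; split=> // l l0.
  rewrite coefB coefXnM coef1 eqn0Ngt l0 subr0; case: ifP => _; [exact: vge0 | exact: vG].
(* A Smith form may have zero diagonal entries; dominance excludes them, and the normalisation then
   makes all entries monic. *)
have nz i : A i i != 0.
  by have [n0 _] := dom i; apply: contra_neq n0 => ->; rewrite coef0.
exists (fun i => A i i); last by move=> i; apply/np_slopes_pos_dominant.
split; first by exists P, Q; do 2!split=> //; rewrite -eA {1}eAd.
split=> [i|i j eij]; last by apply: Ad.
by have [/eqP|//] := An i i erefl; rewrite (negPf (nz i)).
Qed.

(* Writing [lam i = (1 - f i) c i] with [c i] the constant coefficient, the matrix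
   [1 - P' diag(f)^k P] is a right multiple of [t - D]; evaluating its coefficients
   at [D] by telescoping gives the relation, with small coefficients for large [k]. *)
Lemma invariant_factors_relation lam : invariant_factors D lam ->
  (forall i, const_dominant v (lam i)) ->
  exists n, exists2 E : 'I_n -> 'M[R]_d, (forall k, vmx v (E k) 1)
    & \sum_(k < n) D ^+ k.+1 *m E k = 1%:M.
Proof.
move=> [[P [Q [EP [EQ eL]]] _]] dom; have hE := euclidean_poly hL.
have [_ [P' [_ PP' P'P]]] := elemprod_inv (euclid_sub hE) EP.
pose a i := ((lam i)`_0)^-1; pose f i : {poly R} := 1 - lam i * (a i)%:P.
have vf i : pvge v (f i) 1.
  have [n0 dm] := dom i; case=> [|l].
    by rewrite coefB coef1 coefMC (div_mulrV hL) // subrr; left.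
  rewrite coefB coef1 sub0r; apply: (vge_opp hL); rewrite coefMC.
  have -> : 1 = v (lam i)`_0 + 1 + v (a i) by rewrite (vinv hL) //; lia.
  by apply: (vge_mul hL); [exact: dm | right].
have f0 i : (f i)`_0 = 0.
  by have [n0 _] := dom i; rewrite coefB coef1 coefMC (div_mulrV hL) // subrr.
have vfk i k : pvge v (f i ^+ k) k%:Z.
  elim: k => [|k IH]; last by rewrite exprS intS; apply: (pvge_mul hL).
  by move=> l; rewrite expr0 coef1; apply: (vge_bool hL).
have [b Pb] := pvmx_bounded v P; have [b' P'b'] := pvmx_bounded v P'.
(* [f i ^+ k] has Gauss valuation at least [k], one more than the loss [b + b'] under
   conjugation. *)
pose k := (b + b').+1.
pose F := diag_poly (fun i => f i ^+ k); pose G := P' *m F *m P.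
have vG : pvmx v G 1.
  have vF : pvmx v F k%:Z.
    by move=> i j; rewrite mxE; case: eqP => // _ l; rewrite coef0; left.
  have := pvmx_mul hL (pvmx_mul hL P'b' vF) Pb.
  by have -> : - b'%:Z + k%:Z - b%:Z = 1 by rewrite /k; lia.
(* The constant coefficient of [1 - G] is then exactly the identity, the right-hand side of the
   relation sought. *)
have G0 i j : (G i j)`_0 = 0.
  rewrite mxE coef_sum big1 // => l _; rewrite coef0M mxE coef_sum big1 ?mul0r // => l' _.
  rewrite coef0M mxE; case: eqP => _; last by rewrite coef0 mulr0.
  by rewrite /k exprS coef0M f0 mul0r mulr0.
have [W eW] : exists W, 1%:M - G = charmx D *m W.
  pose q i := (a i)%:P * \sum_(l < k) f i ^+ l.
  exists (Q *m diag_poly q *m P).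
  have e : P *m charmx D *m Q *m diag_poly q = 1%:M - F.
    rewrite eL -/(diag_poly lam) diag_poly_mul; apply/matrixP=> i j; rewrite !mxE.
    case: eqP => _; last by rewrite subr0.
    have := subrX1 (f i) k; rewrite -[f i ^+ k - 1]opprB -[f i - 1]opprB mulNr => /oppr_inj ->.
    by rewrite /q mulrA [X in 1 - X]/f subKr.
  have <- : P' *m (1%:M - F) *m P = 1%:M - G by rewrite mulmxBr mulmx1 mulmxBl P'P.
  rewrite -e.
  by rewrite !mulmxA P'P mul1mx.
clearbody G.
pose cf (M : 'M[{poly R}]_d) l : 'M[R]_d := \matrix_(i, j) (M i j)`_l.
have [n Wn] : exists n, forall l, (n <= l)%N -> cf W l = 0.
  exists (\max_i \max_j size (W i j)) => l le_l; apply/matrixP=> i j; rewrite !mxE.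
  rewrite nth_default //; apply: leq_trans le_l; apply: leq_trans (leq_bigmax i).
  exact: (leq_bigmax (F := fun j => size (W i j)) j).
(* [W] stands to the right of [charmx D], so [D] multiplies coefficients from the left, as (2')
   demands. *)
have cW l : cf (charmx D *m W) l = (if l is l'.+1 then cf W l' else 0) - D *m cf W l.
  apply/matrixP=> i j; rewrite /charmx mulmxBl mul_scalar_mx !mxE coefB coefXM coef_sum.
  congr (_ - _); first by case: l => [|l] /=; rewrite mxE.
  by apply: eq_bigr => x _; rewrite !mxE coefCM.
have cG0 : D *m cf W 0 = - 1%:M.
  have := cW 0; rewrite -eW sub0r => e; apply: oppr_inj; rewrite -e opprK.
  by apply/matrixP=> i j; rewrite !mxE coefB G0 subr0; case: eqP; rewrite ?coef1 ?coef0.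
have cGS l : cf G l.+1 = D *m cf W l.+1 - cf W l.
  have := cW l.+1; rewrite -eW => e; apply: oppr_inj; rewrite opprB -e.
  apply/matrixP=> i j; rewrite !mxE coefB.
  by case: eqP; rewrite ?coef1 ?coef0 sub0r.
exists n, (fun l => cf G l.+1) => [l i j|]; first by rewrite mxE; apply: vG.
have tele m : \sum_(l < m) D ^+ l.+1 *m cf G l.+1 = D ^+ m.+1 *m cf W m + 1%:M.
  elim: m => [|m IH]; first by rewrite big_ord0 expr1 cG0 addNr.
  rewrite big_ord_recr /= IH cGS mulmxBr mulmxA.
  have -> : D ^+ m.+1 *m D = D ^+ m.+2 by rewrite [RHS]exprSr.
  by rewrite addrC -addrA addKr.
by rewrite tele Wn // mulmx0 add0r.
Qed.

Lemma last_factor_dominant lam : invariant_factors D lam ->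
  (forall i : 'I_d, i.+1 = d -> const_dominant v (lam i)) ->
  forall i, const_dominant v (lam i).
Proof.
move=> [_ [_ dvd]] Hlast i; have [m] := ubnP (d - i); elim: m i => // m IH i lt_m.
have [ei|ni] := eqVneq i.+1 d; first exact: Hlast.
have lt_i : (i.+1 < d)%N by rewrite ltn_neqAle ni ltn_ord.
have [[c ec] _] := dvd i (Ordinal lt_i) erefl.
have := IH (Ordinal lt_i); rewrite ec => dm.
apply: (proj1 (const_dominant_mul hL (dm _))) => /=.
by move: lt_m; rewrite !ltnS; apply: leq_trans; rewrite ltn_sub2l.
Qed.

End Expanding.

(** * The cycle of implications *)

Theorem theorem4p1 (R : unitRingType) (v : R -> int) (sigma : R)
  (hL : complete_dv_skew_field v sigma)
  (d : nat) (hd : (0 < d)%N) (D : 'M[R]_d) (hD : D != 0)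
  (s : nat -> nat) (hs : forall n : nat, (0 < n)%N -> is_sn v D n (s n)) :
  [<->
    (* (1) *)
    (exists n : nat, (0 < n)%N /\
       rank_mod v sigma (s n) (sigma ^+ s n *: D ^+ n) d);
    (* (2) *)
    (exists n : nat, (0 < n)%N /\
       rank_mod v sigma (s n)
         (\mxcol_(k < n) (sigma ^+ s n *: D ^+ k.+1) : 'M[R]_(\sum_(k < n) d, d)) d);
    (* (2') *)
    (exists n : nat, (0 < n)%N /\
       rank_mod v sigma (s n)
         (\mxrow_(k < n) (sigma ^+ s n *: D ^+ k.+1) : 'M[R]_(d, \sum_(k < n) d)) d);
    (* (3) *)
    (exists lam : 'I_d -> {poly R}, invariant_factors D lam /\
       forall i : 'I_d, i.+1 = d -> np_slopes_pos v (lam i))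
  ].
Proof.
tfae.
- move=> [n [n0 /(rank_mod_power hL (hs n n0) n0)[E vE ED]]]; exists n; split=> //.
  apply/(rank_mod_mxcol hL (hs n n0)).
  (* (1) is the special case of (2) where only the coefficient of the last block is non-zero. *)
  exists (fun k : 'I_n => if k.+1 == n then E else 0) => [k|].
    by case: eqP => // _ i j; rewrite mxE; left.
  case: n n0 ED => // n _ ED; rewrite big_ord_recr /= eqxx ED big1 ?add0r // => k _.
  by rewrite eqSS ltn_eqF ?mul0mx.
- move=> [n [n0 /(rank_mod_mxcol hL (hs n n0))[E vE /(expanding_left hL vE)]]].
  (* The coefficients change sides here, through a power relation valid on both sides; the number of
     blocks changes from [n] to [m]. *)
  move=> /expanding_power[m [F [m0 vF _ DF]]]; exists m; split=> //.
  apply/(rank_mod_mxrow hL (hs m m0)).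
  exists (fun k : 'I_m => if k.+1 == m then F else 0) => [k|].
    by case: eqP => // _ i j; rewrite mxE; left.
  case: m m0 DF => // m _ DF; rewrite big_ord_recr /= eqxx -[_ *m F]/(_ * F) DF.
  rewrite big1 ?add0r // => k _.
  by rewrite eqSS ltn_eqF ?mulmx0.
- move=> [n [n0 /(rank_mod_mxrow hL (hs n n0))[E vE /(expanding_right hL vE)]]].
  by move=> /(expanding_invariant_factors hL)[lam Hlam pos]; exists lam.
move=> [lam [Hlam pos]].
have dom : forall i, const_dominant v (lam i).
  by apply: (last_factor_dominant hL Hlam) => i /pos /np_slopes_pos_dominant.
have [n [E vE /(expanding_right hL vE)]] := invariant_factors_relation hL Hlam dom.
move=> /expanding_power[m [F [m0 vF FD _]]]; exists m; split=> //.
by apply/(rank_mod_power hL (hs m m0) m0); exists F.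
Qed.
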